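(* There exist absolute constants $c, C > 0$ such that for every integer $n \ge 3$ and every real $p \ge 1$, $$\frac{c\sqrt{n}}{\sqrt{\log\log n}} \;\le\; \gamma(p,n) \;\le\; C\sqrt{pn}.$$
   Context: $(x,y)$ is the standard scalar product in $\mathbb{R}^n$, $|x|$ the Euclidean norm, $S^{n-1}=\{\xi\in\mathbb{R}^n: |\xi|=1\}$, $\log$ is the natural logarithm, and $|K|$ denotes the ($n$-dimensional) volume of a set $K\subseteq\mathbb{R}^n$. A convex body is a compact convex set with non-empty interior; it is centrally-symmetric if $K=-K$. For $K\subseteq\mathbb{R}^n$, $f\ge 0$ on $K$, $p\ge 1$ and $\xi\in S^{n-1}$ put $$M_{K,f,p}(\xi)=\int_K |(x,\xi)|^p f(x)\,dx.$$ $\gamma(p,n)$ denotes the smallest number $\gamma>0$ such that $$\min_{\xi\in S^{n-1}} M_{K,f,p}(\xi)\le \gamma^p\,|K|^{p/n}\int_K f(x)\,dx$$ for all centrally-symmetric convex bodies $K\subseteq\mathbb{R}^n$ and all even continuous functions $f\ge 0$ on $K$. *)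

(* Defs.v *)
From HB Require Import structures.
From mathcomp Require Import all_boot all_order all_algebra.
From mathcomp Require Import all_classical all_reals all_analysis.

Set Implicit Arguments.
Unset Strict Implicit.
Unset Printing Implicit Defensive.

Import Order.TTheory GRing.Theory Num.Theory.
Import numFieldNormedType.Exports.

Local Open Scope classical_set_scope.
Local Open Scope ring_scope.

(* R^n carries the sigma-algebra generated by the coordinates, which is also the
   one generated by the open sets. *)
Definition measure_rV_display : measure_display.
Proof. exact: default_measure_display. Qed.

Section measurable_rV.
Context {R : realType} (n : nat).

Definition coord_rV (i : 'I_n) (x : 'rV[R]_n) : measurableTypeR R := x 0 i.

Let rV_set0 : g_sigma_preimage coord_rV set0.
Proof. exact: sigma_algebra0. Qed.

Let rV_setC A : g_sigma_preimage coord_rV A -> g_sigma_preimage coord_rV (~` A).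
Proof. exact: sigma_algebraC. Qed.

Let rV_bigcup (F : _^nat) : (forall i, g_sigma_preimage coord_rV (F i)) ->
  g_sigma_preimage coord_rV (\bigcup_i (F i)).
Proof. exact: sigma_algebra_bigcup. Qed.

HB.instance Definition _ := @isMeasurable.Build measure_rV_display
  'rV[R]_n (g_sigma_preimage coord_rV) rV_set0 rV_setC rV_bigcup.

End measurable_rV.

Section rV_cons.
Context {R : realType}.

Definition rV_cons (n : nat) (z : measurableTypeR R * 'rV[R]_n) : 'rV[R]_n.+1 :=
  \row_i (if unlift ord0 i is Some j then z.2 0 j else z.1).

Lemma measurable_coord_rV n (i : 'I_n) :
  measurable_fun [set: 'rV[R]_n] (coord_rV i).
Proof.
move=> _ Y mY; rewrite setTI; apply: sub_sigma_algebra => /=.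
rewrite -bigcup_seq/=; exists i => /=; first by rewrite mem_index_enum.
by exists Y => //; rewrite setTI.
Qed.

Lemma measurable_fun_rVP d (T : measurableType d) n (f : T -> 'rV[R]_n) :
  (forall i, measurable_fun setT (coord_rV i \o f)) -> measurable_fun setT f.
Proof.
move=> mf _ Y.
move=> /(_ [set Y | measurable ([set: T] `&` f @^-1` Y)]) /=; apply.
split; first split=> /=.
- by rewrite preimage_set0 setI0; exact: measurable0.
- move=> A; rewrite !setTI setTD preimage_setC => mA; exact: measurableC.
- by move=> A mA; rewrite preimage_bigcup setI_bigcupr; exact: bigcup_measurable.
rewrite -bigcup_seq/= => A [i _] [B mB <-] /=.
by rewrite [X in _ @^-1` X]setTI; exact: mf.
Qed.

Lemma measurable_rV_cons n : measurable_fun setT (@rV_cons n).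
Proof.
apply: measurable_fun_rVP => i; case: (unliftP ord0 i) => [j|] ->.
  rewrite (_ : _ \o _ = coord_rV j \o snd).
    by apply: measurableT_comp => //; exact: measurable_coord_rV.
  by apply/funext => z; rewrite /= /coord_rV mxE liftK.
rewrite (_ : _ \o _ = fst); first exact: measurable_fst.
by apply/funext => z; rewrite /= /coord_rV mxE unlift_none.
Qed.

End rV_cons.

(* Lebesgue measure on R^n, by iterated product. *)
Fixpoint lebesgue_rV (R : realType) (n : nat) : set 'rV[R]_n -> \bar R :=
  match n with
  | 0 => \d_(0 : 'rV[R]_0)
  | m.+1 => pushforward (lebesgue_measure \x @lebesgue_rV R m)%E (@rV_cons R m)
  end.
Arguments lebesgue_rV R n : clear implicits.

Section lebesgue_rV_measure.
Context {R : realType}.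

Let rV_uncons n (x : 'rV[R]_n.+1) : measurableTypeR R * 'rV[R]_n :=
  (x 0 ord0, \row_j x 0 (lift ord0 j)).

Let rV_consK n : cancel (@rV_cons R n) (@rV_uncons n).
Proof.
move=> [a v]; rewrite /rV_uncons /rV_cons mxE unlift_none; congr pair.
by apply/rowP => j; rewrite !mxE liftK.
Qed.

Let rV_unconsK n : cancel (@rV_uncons n) (@rV_cons R n).
Proof.
move=> x; apply/rowP => i; rewrite mxE /=.
by case: unliftP => [j|] -> //; rewrite mxE.
Qed.

Let measurable_rV_uncons n : measurable_fun setT (@rV_uncons n).
Proof.
apply: measurable_fun_pair => /=; first exact: (measurable_coord_rV ord0).
apply: measurable_fun_rVP => j.
rewrite (_ : _ \o _ = coord_rV (lift ord0 j)); first exact: measurable_coord_rV.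
by apply/funext => x; rewrite /= /coord_rV mxE.
Qed.

Let lebesgue_rV_sigma_finite_measure n :
  exists m : {sigma_finite_measure set 'rV[R]_n -> \bar R},
    m = lebesgue_rV R n :> (set _ -> _).
Proof.
elim: n => [|n [m mE]]; first by exists \d_(0 : 'rV[R]_0).
have mc := @measurable_rV_cons R n.
have [F [FT ndF Foo]] := (sigma_finiteP _ _).1 (sigma_finiteT (@lebesgue_measure R)).
have [G [GT ndG Goo]] := (sigma_finiteP _ _).1 (sigma_finiteT m).
have sf : sigma_finite setT (lebesgue_rV R n.+1).
  exists (fun k => @rV_uncons n @^-1` (F k `*` G k)).
    apply/seteqP; split => // x _.
    have [i _ Fi] : (\bigcup_i F i) (x 0 ord0) by rewrite -FT.
    have [j _ Gj] : (\bigcup_j G j) (\row_j x 0 (lift ord0 j)) by rewrite -GT.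
    exists (maxn i j) => //; split.
      by move: Fi; exact/subsetPset/ndF/leq_maxl.
    by move: Gj; exact/subsetPset/ndG/leq_maxr.
  move=> k; have [mF Fk] := Foo k; have [mG Gk] := Goo k; split.
    rewrite -[X in measurable X]setTI; apply: measurable_rV_uncons => //.
    exact: measurableX.
  rewrite /= /pushforward -comp_preimage -mE.
  rewrite (_ : _ \o _ = id); last by apply/funext => z; exact: rV_consK.
  by rewrite product_measure1E// lte_mul_pinfty// ge0_fin_numE.
have [mu muE] : exists mu : {measure set 'rV[R]_n.+1 -> \bar R},
    mu = lebesgue_rV R n.+1 :> (set _ -> _).
  rewrite /= -mE.
  unshelve eexists (pushforward (lebesgue_measure \x m)%E (@rV_cons R n)).
    exact: mc.
  by [].
rewrite -muE in sf.
pose sfin := isSFinite.Build _ _ _ _ (sfinite_measure_sigma_finite sf).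
pose sigfin := isSigmaFinite.Build _ _ _ _ sf.
pose mu' := HB.pack_for (SigmaFiniteMeasure.type 'rV[R]_n.+1 R)
  (Measure.sort mu) sfin sigfin.
by exists mu'.
Qed.

Let lebesgue_rV0 n : lebesgue_rV R n set0 = 0%E.
Proof. by have [m <-] := lebesgue_rV_sigma_finite_measure n. Qed.

Let lebesgue_rV_ge0 n A : (0 <= lebesgue_rV R n A)%E.
Proof. by have [m <-] := lebesgue_rV_sigma_finite_measure n. Qed.

Let lebesgue_rV_sigma_additive n : semi_sigma_additive (lebesgue_rV R n).
Proof.
have [m <-] := lebesgue_rV_sigma_finite_measure n.
exact: measure_semi_sigma_additive.
Qed.

HB.instance Definition _ n := isMeasure.Build _ _ _ (lebesgue_rV R n)
  (lebesgue_rV0 n) (@lebesgue_rV_ge0 n) (@lebesgue_rV_sigma_additive n).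

Let lebesgue_rV_sigma_finite n : sigma_finite setT (lebesgue_rV R n).
Proof.
by have [m <-] := lebesgue_rV_sigma_finite_measure n; exact: sigma_finiteT.
Qed.

HB.instance Definition _ n := Measure_isSigmaFinite.Build _ _ _
  (lebesgue_rV R n) (lebesgue_rV_sigma_finite n).

End lebesgue_rV_measure.

Lemma lebesgue_rV_box (R : realType) n (A : 'I_n -> set (measurableTypeR R)) :
  (forall i, measurable (A i)) ->
  lebesgue_rV R n [set x | forall i, A i (x 0 i)] =
  (\prod_(i < n) lebesgue_measure (A i))%E.
Proof.
elim: n A => [|n IHn] A mA.
  by rewrite big_ord0 /= diracE mem_set// => -[].
rewrite big_ord_recl -IHn; last by move=> i; exact: mA.
have mbox : measurable [set x : 'rV[R]_n | forall i, A (lift ord0 i) (x 0 i)].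
  rewrite (_ : [set _ | _] =
      \bigcap_(i in [set: 'I_n]) (coord_rV i @^-1` A (lift ord0 i))).
    apply: fin_bigcap_measurable => // i _.
    by rewrite -[X in measurable X]setTI; exact: measurable_coord_rV.
  by apply/seteqP; split => x /= xA i; [move=> _; exact: xA|exact: (xA i I)].
rewrite -product_measure1E//=; congr (product_measure1 _ _ _).
apply/seteqP; split => -[a v] /=.
  move=> H; split => [|i]; first by have := H ord0; rewrite mxE unlift_none.
  by have := H (lift ord0 i); rewrite mxE liftK.
move=> [Aa Av] i; rewrite mxE.
by case: unliftP => [j|] -> //; exact: Av.
Qed.

Section slicing_constant.
Context {R : realType} {n : nat}.
Implicit Types (x y xi : 'rV[R]_n) (K : set 'rV[R]_n) (f : 'rV[R]_n -> R).

Definition dotv x y : R := \sum_i x 0 i * y 0 i.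

(* Not [`|x|], which is the sup norm on matrices. *)
Definition enorm x : R := Num.sqrt (dotv x x).

Definition sphere : set 'rV[R]_n := [set xi | enorm xi = 1].

Definition vol K : \bar R := lebesgue_rV R n K.

Definition convex_body K :=
  [/\ compact K, convex_set K & K° !=set0].

Definition centrally_symmetric K := [set - x | x in K] = K.

(* [f] is a function on [K]; its values outside [K] are irrelevant. *)
Definition even_on K f := forall x, K x -> f (- x) = f x.

Definition moment K f (p : R) xi : \bar R :=
  (\int[lebesgue_rV R n]_(x in K) (`|dotv x xi| `^ p * f x)%:E)%E.

End slicing_constant.

Definition is_least d (T : porderType d) (A : set T) (a : T) :=
  A a /\ lbound A a.

Section slicing_constant_gamma.
Context {R : realType}.
Local Open Scope ereal_scope.

Definition moment_bound (p : R) (n : nat) (gamma : R) :=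
  forall (K : set 'rV[R]_n) (f : 'rV[R]_n -> R),
    convex_body K -> centrally_symmetric K ->
    {within K, continuous f} -> (forall x, K x -> 0 <= f x)%R -> even_on K f ->
    exists2 m, is_least (moment K f p @` sphere) m &
      m <= (gamma `^ p)%:E * vol K `^ (p / n%:R) *
           \int[lebesgue_rV R n]_(x in K) (f x)%:E.

Definition is_gamma (p : R) (n : nat) (gamma : R) :=
  is_least [set g : R | (0 < g)%R /\ moment_bound p n g] gamma.

End slicing_constant_gamma.

(* Main.v *)
(* Upper bound. A nearly D-optimal measure on K provides a matrix A with <A^-1 x, x> <= 3 n on K and,
   by the Cauchy-Binet formula and |det (x_1, ..., x_n)| <= n^n |K| for x_j in K, with
   det A <= (n^n |K|)^2 / n!. A random vector xi with Rademacher coefficients and covariance A^-1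
   then has moments E |<x, xi>|^p of order (p n)^(p/2) for x in K, while E |xi|^2 = tr A^-1 is at
   least of order |K|^(-2/n); averaging the p-th moment of f over xi yields a good direction.

   Lower bound. For N of order n there is an N x n sign matrix with rows x_i such that
   sum_i |<x_i, xi>| >= c N |xi| for all xi. Let K be the convex hull of the points x_i and - x_i
   plus a cube of side 2 / sqrt n, and let f be a sum of bumps centred at these points. The moments
   of f are bounded below by the sums above, and |K|^(1/n) is at most C / sqrt n by a covering
   argument. Nets are produced throughout by rounding a vector to an integer vector so that its
   image under a given matrix moves little on average, as in the random rounding of Klartag and
   Livshyts; this removes the factor sqrt (log log n) from the lower bound. *)
Require Import Defs.
From mathcomp Require Import all_boot all_order all_algebra.
From mathcomp Require Import all_classical all_reals all_analysis.
From mathcomp Require Import measurable_realfun perm ring lra.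

Set Implicit Arguments.
Unset Strict Implicit.
Unset Printing Implicit Defensive.

Import Order.TTheory GRing.Theory Num.Theory.
Import numFieldNormedType.Exports.

Local Open Scope classical_set_scope.
Local Open Scope ring_scope.

(** The constants may not depend on p, yet the random directions of the upper bound have a
    controlled |xi|^2 only on average. Their p-th moments are therefore compared with |xi|^2 minus
    half its mean, which needs no concentration of |xi|. This works for p >= 2, and p < 2 is deduced
    from p = 2. In the lower bound the first moment alone serves every p. A design that is optimal
    up to a constant factor replaces the exact optimum behind John's theorem, so a supremum of
    determinants suffices and no compactness of the set of designs is involved. The bumps of f need
    not be narrow: for bumps centred at v and - v the inequality |(x + v, xi)| + |(x - v, xi)| >= 2
    |(v, xi)| removes the dependence on x. Their width can thus be that of the cubes in the
    covering. As gamma(p, n) is a least element, it also has to be shown that the infimum of the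
    admissible constants is positive and admissible. The lower bound obtained is c sqrt n; it
    implies the stated one because ln (ln n) >= ln (ln 3) > 0 for n >= 3. *)

(** * Determinant identities *)

Section determinants.

Lemma det_sum_rows (R : comNzRingType) (n : nat) (I : finType)
    (c : 'I_n -> I -> R) (v : I -> 'rV[R]_n) :
  \det (\matrix_j (\sum_i c j i *: v i)) =
  \sum_(phi : {ffun 'I_n -> I})
     (\prod_j c j (phi j)) * \det (\matrix_j v (phi j)).
Proof.
rewrite /determinant.
under eq_bigr => s _.
  under eq_bigr => j _.
    rewrite mxE summxE; under eq_bigr do rewrite mxE.
  over.
  rewrite bigA_distr_bigA /= mulr_sumr.
over.
rewrite exchange_big /=; apply: eq_bigr => phi _.
rewrite mulr_sumr; apply: eq_bigr => s _.
rewrite mulrCA big_split /=; congr (_ * (_ * _)).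
by apply: eq_bigr => j _; rewrite mxE.
Qed.

(** The Cauchy-Binet formula, summed over all maps instead of n-element subsets, whence the factor
    n!. Each of the n! copies of det A is expanded along the rows permuted by its own s; the sum
    over s then rebuilds the second determinant. *)
Lemma det_gram (R : comNzRingType) (n : nat) (I : finType) (w : I -> R)
    (v : I -> 'rV[R]_n) :
  n`!%:R * \det (\sum_i w i *: ((v i)^T *m v i)) =
  \sum_(phi : {ffun 'I_n -> I})
     (\prod_j w (phi j)) * \det (\matrix_j v (phi j)) ^+ 2.
Proof.
set A := \sum_i _.
have rowA (s : 'S_n) : row_perm s A =
    \matrix_j (\sum_i (w i * v i 0 (s j)) *: v i).
  apply/matrixP => j k; rewrite !mxE /A !summxE; apply: eq_bigr => i _.
  by rewrite !mxE big_ord1 !mxE mulrA.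
have detA (s : 'S_n) : \det A = \sum_(phi : {ffun 'I_n -> I})
    (-1) ^+ s * (\prod_j (w (phi j) * v (phi j) 0 (s j))) *
      \det (\matrix_j v (phi j)).
  transitivity ((-1) ^+ s * \det (row_perm s A)).
    by rewrite row_permE det_mulmx det_perm mulrA -expr2 sqrr_sign mul1r.
  rewrite rowA det_sum_rows mulr_sumr.
  by apply: eq_bigr => phi _; rewrite mulrA.
have -> : n`!%:R * \det A = \sum_(s : 'S_n) \det A.
  by rewrite sumr_const card_Sn mulr_natl.
under eq_bigr => s _ do rewrite (detA s).
rewrite exchange_big /=; apply: eq_bigr => phi _.
rewrite -mulr_suml expr2 mulrA; congr (_ * _).
rewrite /determinant mulr_sumr; apply: eq_bigr => s _.
rewrite mulrCA big_split /=; congr (_ * (_ * _)).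
by apply: eq_bigr => j _; rewrite mxE.
Qed.

(** Both sides are the determinant of one bordered matrix [B], factored by eliminating either of its
    diagonal blocks. *)
Lemma det_rank1_update (R : comNzRingType) (n : nat) (c : 'cV[R]_n)
    (r : 'rV[R]_n) : \det (1%:M + c *m r) = 1 + (r *m c) 0 0.
Proof.
pose B := block_mx (1%:M : 'M[R]_1) (- r) c 1%:M.
have E1 : B = block_mx (1%:M : 'M[R]_1) 0 c 1%:M *m
              block_mx 1%:M (- r) 0 (1%:M + c *m r).
  rewrite mulmx_block !mul0mx !mulmx0 !mul1mx !mulmx1 !addr0.
  by rewrite mulmxN addrCA addNr addr0.
have E2 : B = block_mx (1%:M + r *m c) (- r) 0 1%:M *m
              block_mx 1%:M 0 c 1%:M.
  by rewrite mulmx_block !mul0mx !mulmx0 !mul1mx !mulmx1 !add0r mulNmx addrK.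
have : \det B = \det B by [].
rewrite {1}E1 E2 !det_mulmx !det_ublock !det_lblock !det1 !mul1r !mulr1 => ->.
by rewrite det_mx11 !mxE.
Qed.

End determinants.

(** * Positive definite matrices: Hadamard's inequality *)

Section positive_definite.
Variable R : realFieldType.

Definition posdef n (B : 'M[R]_n) :=
  B^T = B /\ forall x : 'rV_n, x != 0 -> 0 < (x *m B *m x^T) 0 0.

(* Hadamard's inequality, by induction on the Schur complement of the first diagonal entry. *)
Lemma posdef_det_le_diag n (B : 'M[R]_n) : posdef B ->
  0 < \det B /\ \det B <= \prod_i B i i.
Proof.
elim: n B => [|n IHn] B [Bs Bp]; first by rewrite det_mx00 big_ord0; split.
have Bsym i j : B i j = B j i by rewrite -[in LHS]Bs mxE.
pose a := B 0 0.
have a0 : 0 < a.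
  have := Bp (delta_mx 0 0); rewrite -rowE => /(_ _)/wrap[].
    apply/eqP => /matrixP/(_ 0 0)/eqP; rewrite !mxE !eqxx /= oner_eq0 //.
  by rewrite trmx_delta -colE !mxE.
pose B' : 'M[R]_(1 + n) := B.
pose b := ursubmx B'.
have Bb : B' = block_mx a%:M b b^T (drsubmx B').
  rewrite -[LHS]submxK; congr block_mx.
    by apply/matrixP => i j; rewrite !ord1 !mxE /= mulr1n; congr (B _ _); apply/val_inj.
  by apply/matrixP => i j; rewrite !mxE; exact: Bsym.
pose D := drsubmx B'.
pose S := D - a^-1 *: (b^T *m b).
have fact : B' = block_mx (1%:M : 'M[R]_1) 0 (a^-1 *: b^T) 1%:M *m
                 block_mx a%:M b 0 S.
  rewrite mulmx_block !mul0mx !mulmx0 !mul1mx !addr0 -scalemxAl mul_mx_scalar.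
  rewrite scalerA mulVf ?gt_eqF// scale1r -scalemxAl.
  by rewrite [in RHS]addrC /S subrK.
have detB : \det B = a * \det S.
  change (\det B) with (\det B'); rewrite fact det_mulmx det_lblock det_ublock.
  by rewrite !det1 det_scalar1 !mul1r.
have DS : S^T = S.
  rewrite /S linearB linearZ /= trmx_mul trmxK; congr (_ - _).
  by rewrite /D; apply/matrixP => i j; rewrite !mxE; exact: Bsym.
have Sp : posdef S.
  split=> // y y0.
  (* The first entry minimises the form of [B] for the given y; the minimum is the form of the Schur
     complement at y. *)
  pose x : 'rV_(1 + n) := row_mx (- a^-1 *: (y *m b^T)) y.
  have x0 : x != 0.
    apply: contra_neq y0 => /(congr1 (@rsubmx _ _ _ _)).
    by rewrite row_mxKr linear0.
  have := Bp x x0.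
  rewrite -[x *m B *m _]/(x *m B' *m x^T) fact mulmxA /x mul_row_block !mulmx1 !mulmx0.
  rewrite add0r -scalemxAr scaleNr addNr mul_row_block !mul0mx !add0r.
  by rewrite tr_row_mx mul_row_col mulmx0 mul0mx add0r.
have [S0 Sle] := IHn S Sp.
rewrite detB mulr_gt0//; split=> //.
rewrite big_ord_recl -/a ler_pM2l//; apply: (le_trans Sle).
apply: ler_prod => i _; apply/andP; split.
  have [_ /(_ (delta_mx 0 i))] := Sp; rewrite -rowE trmx_delta -colE !mxE.
  move=> /(_ _)/ltW; apply.
  by apply/eqP => /matrixP/(_ 0 i)/eqP; rewrite !mxE !eqxx /= oner_eq0.
rewrite !mxE big_ord1 !mxE -[X in X - _]addr0.
have -> : B' (rshift 1 i) (rshift 1 i) = B (lift ord0 i) (lift ord0 i).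
  by congr (B _ _); apply/val_inj.
by rewrite addr0 lerBlDr lerDl mulr_ge0 ?invr_ge0 ?(ltW a0)//; exact: sqr_ge0.
Qed.

(** Hadamard's inequality and the AM-GM inequality for the diagonal entries; no eigenvalues are
    involved. *)
Lemma posdef_det_le_trace n (B : 'M[R]_n) : posdef B ->
  \det B <= (\tr B / n%:R) ^+ n.
Proof.
move=> pB; have [_ /le_trans] := posdef_det_le_diag pB; apply.
have := (@leif_AGM R _ (fun=> true) (fun i : 'I_n => B i i)).
rewrite card_ord => /(_ _)/wrap[] => [i _|[+ _]]; last exact.
have [_ /(_ (delta_mx 0 i))] := pB; rewrite -rowE trmx_delta -colE !mxE.
move=> /(_ _)/ltW; apply.
by apply/eqP => /matrixP/(_ 0 i)/eqP; rewrite !mxE !eqxx /= oner_eq0.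
Qed.

End positive_definite.

Lemma bernoulli_ge (R : realDomainType) (t : R) (n : nat) : 0 <= t <= 1 ->
  1 - n%:R * t <= (1 - t) ^+ n.
Proof.
move=> /andP[t0 t1]; elim: n => [|n IHn]; first by rewrite mul0r subr0 expr0.
rewrite exprS; apply: le_trans (ler_wpM2l _ IHn); last by rewrite subr_ge0.
have : 0 <= n%:R * (t * t) by rewrite !mulr_ge0.
by rewrite -natr1; lra.
Qed.

(** * Nearly D-optimal designs *)

Section loewner_position.
Variables (R : realType) (n : nat) (K : set 'rV[R]_n) (M : R).

Let design_mx (s : seq (R * 'rV[R]_n)) : 'M[R]_n :=
  \sum_(wx <- s) wx.1 *: (wx.2^T *m wx.2).

Let design (s : seq (R * 'rV[R]_n)) :=
  {in s, forall wx, 0 <= wx.1 /\ K wx.2} /\ \sum_(wx <- s) wx.1 = 1.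

Hypothesis det_le : forall x : 'I_n -> 'rV[R]_n, (forall j, K (x j)) ->
  `|\det (\matrix_j x j)| <= M.

(** By [det_gram], n! times the determinant is a mean of squared determinants of n-tuples from K,
    the product weights having total mass 1. *)
Let det_design_le s : design s -> \det (design_mx s) <= M ^+ 2 / n`!%:R.
Proof.
move=> [sK s1]; rewrite ler_pdivlMr ?ltr0n ?fact_gt0// mulrC.
rewrite /design_mx big_tnth.
rewrite (det_gram (fun i => (tnth (in_tuple s) i).1)
                  (fun i => (tnth (in_tuple s) i).2)).
have sP i : 0 <= (tnth (in_tuple s) i).1 /\ K (tnth (in_tuple s) i).2.
  by apply: sK; rewrite mem_tnth.
apply: (@le_trans _ _ (\sum_(phi : {ffun 'I_n -> 'I_(size s)})
    (\prod_j (tnth (in_tuple s) (phi j)).1) * M ^+ 2)).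
  apply: ler_sum => phi _; apply: ler_wpM2l.
    by apply: prodr_ge0 => j _; case: (sP (phi j)).
  rewrite -[X in X <= _]real_normK ?num_real// ler_pXn2r ?nnegrE//.
  - by apply: det_le => j; case: (sP (phi j)).
  - by apply: le_trans (det_le (x := fun j => (tnth (in_tuple s) (phi j)).2) _)
      => // j; case: (sP (phi j)).
rewrite -mulr_suml.
rewrite -(bigA_distr_bigA (fun (j : 'I_n) i => (tnth (in_tuple s) i).1)) /=.
rewrite big_tnth in s1; under eq_bigr do rewrite s1.
by rewrite big1 ?mul1r.
Qed.

Let design_mix t x s : 0 <= t <= 1 -> K x -> design s ->
  design ((t, x) :: [seq ((1 - t) * wx.1, wx.2) | wx <- s]).
Proof.
move=> /andP[t0 t1] Kx [sK s1]; split.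
  move=> wx; rewrite inE => /predU1P[->//|/mapP[wx' /sK[w0 Kw] ->]/=].
  by rewrite mulr_ge0 ?subr_ge0.
by rewrite big_cons big_map /= -mulr_sumr s1 mulr1 addrC subrK.
Qed.

Let design_mx_mix t x s :
  design_mx ((t, x) :: [seq ((1 - t) * wx.1, wx.2) | wx <- s]) =
  (1 - t) *: design_mx s + t *: (x^T *m x).
Proof.
rewrite /design_mx big_cons big_map /= addrC scaler_sumr; congr (_ + _).
by apply: eq_bigr => wx _; rewrite scalerA.
Qed.

Hypothesis n_gt0 : (0 < n)%N.
Hypothesis full : exists x : 'I_n -> 'rV[R]_n,
  (forall j, K (x j)) /\ \det (\matrix_j x j) != 0.

Let design_gt0 : exists2 s, design s & 0 < \det (design_mx s).
Proof.
have [x [xK dx]] := full.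
have n0 : 0 < n%:R :> R by rewrite ltr0n.
exists [seq (n%:R^-1, x j) | j <- enum 'I_n].
  split.
    by move=> wx /mapP[j _ ->] /=; rewrite invr_ge0 ltW.
  rewrite big_map /= big_enum /= sumr_const card_ord -[LHS]mulr_natl.
  by rewrite mulfV ?gt_eqF.
rewrite /design_mx big_map big_enum /= -scaler_sumr.
have -> : \sum_j (x j)^T *m x j = (\matrix_j x j)^T *m \matrix_j x j.
  apply/matrixP => a b; rewrite summxE !mxE; apply: eq_bigr => j _.
  by rewrite !mxE big_ord1 !mxE.
rewrite detZ det_mulmx det_tr -expr2 mulr_gt0//; last by rewrite exprn_even_gt0.
by rewrite exprn_gt0// invr_gt0.
Qed.

(* A nearly D-optimal design: moving a mass 1/(2n) onto a point x of K multiplies the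
   determinant by (1 - t)^n (1 + t/(1-t) x A^-1 x^T), which therefore is at most 5/4. *)
Let near_optimal : exists s, [/\ design s, 0 < \det (design_mx s) &
  forall x, K x -> (x *m invmx (design_mx s) *m x^T) 0 0 <= 3 * n%:R].
Proof.
pose D := [set \det (design_mx s) | s in design].
have [s0 ds0 s0_gt0] := design_gt0.
have supD : has_sup D.
  split; first by exists (\det (design_mx s0)); exists s0.
  by exists (M ^+ 2 / n`!%:R) => _ [s ds <-]; exact: det_design_le.
have D_gt0 : 0 < sup D.
  by apply: lt_le_trans s0_gt0 _; apply: sup_upper_bound => //; exists s0.
have D5 : 0 < sup D / 5 by rewrite divr_gt0.
have [_ [s ds <-] sS] := sup_adherent D5 supD.
have s_gt0 : 0 < \det (design_mx s) by lra.
exists s; split => // x Kx; set A := design_mx s in sS s_gt0 *.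
have Au : A \in unitmx by rewrite unitmxE unitfE gt_eqF.
set q := (_ *m _) 0 0.
have n0 : 0 < n%:R :> R by rewrite ltr0n.
have n1 : 1 <= n%:R :> R by rewrite ler1n.
pose t : R := (2 * n%:R)^-1.
have nt : t * n%:R = 2^-1 by rewrite /t; field; rewrite gt_eqF.
have t0 : 0 < t by rewrite invr_gt0 mulr_gt0.
have t1 : t <= 2^-1 by rewrite -nt ler_peMr// ltW.
have : \det ((1 - t) *: A + t *: (x^T *m x)) <= sup D.
  apply: sup_upper_bound => //.
  exists ((t, x) :: [seq ((1 - t) * wx.1, wx.2) | wx <- s]); last by rewrite design_mx_mix.
  by apply: design_mix => //; apply/andP; split; lra.
have -> : (1 - t) *: A + t *: (x^T *m x) =
    (1 - t) *: (A *m (1%:M + (t / (1 - t)) *: (invmx A *m x^T) *m x)).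
  rewrite mulmxDr mulmx1 scalerDr -!scalemxAl -!scalemxAr scalerA mulrC.
  by rewrite divfK ?gt_eqF ?subr_gt0//; [rewrite !mulmxA mulmxV// mul1mx|lra].
rewrite detZ det_mulmx det_rank1_update -scalemxAr mulmxA mxE -/q => le_sup.
(* With t = 1/(2n), Bernoulli's inequality gives (1 - t)^n >= 1/2. So the rank one factor is at most
   2 * 5/4 = 5/2, hence t q <= 3/2, which is q <= 3 n. *)
have := @bernoulli_ge R t n; rewrite [n%:R * t]mulrC nt => /(_ _)/wrap[].
  by apply/andP; split; lra.
move=> tn.
have t1_gt0 : 0 < 1 - t by lra.
have u_le : 1 + t / (1 - t) * q <= 5 / 2.
  rewrite leNgt; apply/negP => u_gt.
  set P := \det A * _ in le_sup.
  have P_gt : \det A * (5 / 2) < P by rewrite ltr_pM2l.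
  have : 1 / 2 * P <= (1 - t) ^+ n * P by rewrite ler_wpM2r//; lra.
  lra.
have : t * q <= 3 / 2.
  have : t / (1 - t) * q <= 3 / 2 by lra.
  rewrite mulrAC ler_pdivrMr// => /le_trans; apply; lra.
move=> tq; have -> : q = 2 * n%:R * (t * q).
  by rewrite mulrA [X in X * q](_ : _ = 1) ?mul1r// -mulrA [n%:R * t]mulrC nt; lra.
rewrite (_ : 3 * n%:R = 2 * n%:R * (3 / 2)); last by lra.
by rewrite ler_pM2l// mulr_gt0.
Qed.

(** Writing A = Y^T Y, the matrix Z = Y A^-1 satisfies Z^T Z = A^-1. The first sum is then x A^-1
    x^T, the double sum is tr A^-1, and the last inequality is n! / M^2 <= det A^-1 <= (tr A^-1 /
    n)^n. The rows of Z are the coefficients of the random direction used later. *)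
Lemma loewner_position : exists (N : nat) (Z : 'M[R]_(N, n)),
  (forall x, K x -> \sum_i (Z *m x^T) i 0 ^+ 2 <= 3 * n%:R) /\
  n`!%:R / M ^+ 2 <= ((\sum_i \sum_j Z i j ^+ 2) / n%:R) ^+ n.
Proof.
have [s [ds s_gt0 sK]] := near_optimal.
set A := design_mx s in s_gt0 sK.
have Au : A \in unitmx by rewrite unitmxE unitfE gt_eqF.
pose N := size s.
pose Y : 'M[R]_(N, n) :=
  \matrix_i (Num.sqrt (tnth (in_tuple s) i).1 *: (tnth (in_tuple s) i).2).
have AY : A = Y^T *m Y.
  rewrite /A /design_mx big_tnth; apply/matrixP => a b.
  rewrite summxE !mxE; apply: eq_bigr => i _; rewrite !mxE big_ord1 !mxE.
  have : 0 <= (tnth (in_tuple s) i).1.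
    by case: ds => /(_ (tnth (in_tuple s) i)); rewrite mem_tnth => /(_ isT)[].
  by move=> w0; rewrite mulrACA -expr2 sqr_sqrtr.
have As : A^T = A by rewrite AY trmx_mul trmxK.
have iAs : (invmx A)^T = invmx A by rewrite trmx_inv As.
have sumsq m (v : 'cV[R]_m) : (v^T *m v) 0 0 = \sum_i v i 0 ^+ 2.
  by rewrite mxE; apply: eq_bigr => i _; rewrite mxE expr2.
have Zsq : (Y *m invmx A)^T *m (Y *m invmx A) = invmx A.
  by rewrite trmx_mul iAs mulmxA -(mulmxA _ Y^T) -AY mulVmx// mul1mx.
exists N, (Y *m invmx A); split.
  move=> x Kx; rewrite -sumsq trmx_mul trmxK mulmxA -(mulmxA x) Zsq; exact: sK.
have pA : posdef (invmx A).
  split=> // x x0.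
  have -> : x *m invmx A *m x^T =
      (Y *m invmx A *m x^T)^T *m (Y *m invmx A *m x^T).
    by rewrite -{1}Zsq [in RHS]trmx_mul trmxK !mulmxA.
  rewrite sumsq lt_neqAle sumr_ge0 ?andbT; last by move=> i _; exact: sqr_ge0.
  rewrite eq_sym; apply: contra x0 => /eqP/psumr_eq0P => e0.
  have {}e0 : Y *m invmx A *m x^T = 0.
    apply/colP => i; rewrite [RHS]mxE; apply/eqP; rewrite -sqrf_eq0.
    by rewrite e0// => j _; exact: sqr_ge0.
  have : Y^T *m (Y *m invmx A *m x^T) = 0 by rewrite e0 mulmx0.
  rewrite !mulmxA -AY mulmxV// mul1mx => /(congr1 trmx).
  by rewrite trmxK trmx0 => ->.
have <- : \tr (invmx A) = \sum_i \sum_j (Y *m invmx A) i j ^+ 2.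
  rewrite -{1}Zsq /mxtrace exchange_big /=; apply: eq_bigr => j _.
  by rewrite mxE; apply: eq_bigr => i _; rewrite mxE expr2.
apply: le_trans (posdef_det_le_trace pA).
rewrite det_inv -invf_div lef_pV2 ?posrE//; first exact: det_design_le.
exact: lt_le_trans s_gt0 (det_design_le ds).
Qed.

End loewner_position.

(** * Lebesgue measure under linear maps and translations *)

Section lebesgue_rV_maps.
Context {R : realType}.
Local Notation mu := (lebesgue_rV R).

Lemma measurable_rV_entry n (i : 'I_n) :
  measurable_fun [set: 'rV[R]_n] (fun x : 'rV[R]_n => x 0 i).
Proof. exact: measurable_coord_rV. Qed.

Lemma measurable_mulmxr m n (T : 'M[R]_(m, n)) :
  measurable_fun [set: 'rV[R]_m] (fun x : 'rV[R]_m => x *m T).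
Proof.
apply: measurable_fun_rVP => j.
rewrite (_ : _ \o _ = fun x : 'rV[R]_m => \sum_i x 0 i * T i j); last first.
  by apply/funext => x; rewrite /= /coord_rV mxE.
apply: measurable_sum => i; apply: measurable_funM => //.
exact: measurable_rV_entry.
Qed.

Lemma measurable_shift_rV n (w : 'rV[R]_n) :
  measurable_fun [set: 'rV[R]_n] (fun x : 'rV[R]_n => x + w).
Proof.
apply: measurable_fun_rVP => j.
rewrite (_ : _ \o _ = fun x : 'rV[R]_n => x 0 j + w 0 j); last first.
  by apply/funext => x; rewrite /= /coord_rV mxE.
by apply: measurable_funD => //; exact: measurable_rV_entry.
Qed.

Lemma measurable_preimage d d' (T : measurableType d) (U : measurableType d')
    (f : T -> U) (B : set U) :
  measurable_fun setT f -> measurable B -> measurable (f @^-1` B).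
Proof. by move=> mf mB; rewrite -[X in measurable X]setTI; exact: mf. Qed.

(** The left side is a measure in B, so by uniqueness of Lebesgue measure half-open intervals
    suffice; for t < 0 the preimage is closed at the other end. *)
Lemma lebesgue_measure_affine (t s : R) (B : set R) : t != 0 -> measurable B ->
  (`|t|%:E * lebesgue_measure ((fun a => (a * t + s)%R) @^-1` B) =
   lebesgue_measure B)%E.
Proof.
move=> t0 mB.
have mf : measurable_fun [set: measurableTypeR R]
    (fun a : R => a * t + s : measurableTypeR R).
  by apply: measurable_funD => //; exact: measurable_funM.
have [m1 m1E] : exists m1 : {measure set (measurableTypeR R) -> \bar R},
    m1 = pushforward lebesgue_measure (fun a : measurableTypeR R =>
      (a * t + s : measurableTypeR R)%R) :> (set _ -> _).
  unshelve eexists (pushforward lebesgue_measure (fun a : measurableTypeR R =>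
      (a * t + s : measurableTypeR R)%R)); first exact: mf.
  by [].
pose m : {measure set (measurableTypeR R) -> \bar R} := mscale (NngNum (normr_ge0 t)) m1.
have mE A : m A =
    (`|t|%:E * lebesgue_measure ((fun a => (a * t + s)%R) @^-1` A))%E.
  by rewrite /m /= /mscale m1E.
rewrite -mE; apply/esym/lebesgue_measure_unique => // _ [[x y] _ <-] /=.
rewrite mE; have [t_gt0|t_lt0|t_eq0] := ltgtP t 0; last by rewrite t_eq0 eqxx in t0.
- rewrite (_ : _ @^-1` _ = `[((y - s) / t)%R, ((x - s) / t)%R[%classic); last first.
    apply/seteqP; split => a /=; rewrite !in_itv /=.
      by rewrite ler_ndivrMr// ltr_ndivlMr// -lerBrDr -ltrBlDr => /andP[-> ->].
    by rewrite ler_ndivrMr// ltr_ndivlMr// -lerBrDr -ltrBlDr => /andP[-> ->].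
  rewrite !lebesgue_measure_itv /= !lte_fin ltr_nM2r ?invr_lt0// ltrD2r.
  case: ifPn => _; last by rewrite mule0.
  rewrite -!EFinD -EFinM ltr0_norm//; congr EFin; field; exact: t0.
- rewrite (_ : _ @^-1` _ = `]((x - s) / t)%R, ((y - s) / t)%R]%classic); last first.
    apply/seteqP; split => a /=; rewrite !in_itv /=.
      by rewrite ler_pdivlMr// ltr_pdivrMr// -lerBrDr -ltrBlDr => /andP[-> ->].
    by rewrite ler_pdivlMr// ltr_pdivrMr// -lerBrDr -ltrBlDr => /andP[-> ->].
  rewrite !lebesgue_measure_itv /= !lte_fin ltr_pM2r ?invr_gt0// ltrD2r.
  case: ifPn => _; last by rewrite mule0.
  rewrite -!EFinD -EFinM gtr0_norm//; congr EFin; field; exact: t0.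
Qed.

Lemma lebesgue_rVS1 n (B : set 'rV[R]_n.+1) :
  mu n.+1 B =
  (\int[lebesgue_measure]_a mu n [set v | B (rV_cons (a, v))])%E.
Proof.
apply: eq_integral => a _ /=; congr (lebesgue_rV _ _ _).
by rewrite xsectionE.
Qed.

(** Uniqueness of the product measure reverses the order of integration built into [lebesgue_rV];
    this order suits the maps that change only the first coordinate. *)
Lemma lebesgue_rVS2 n (B : set 'rV[R]_n.+1) : measurable B ->
  mu n.+1 B =
  (\int[mu n]_v lebesgue_measure [set a | B (rV_cons (a, v))])%E.
Proof.
move=> mB.
have mB' : measurable (@rV_cons R n @^-1` B).
  by apply: measurable_preimage => //; exact: measurable_rV_cons.
rewrite /lebesgue_rV -/(lebesgue_rV R n) /pushforward.
transitivity ((lebesgue_measure \x^ mu n)%E (@rV_cons R n @^-1` B)).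
  apply: product_measure_unique => // A1 A2 mA1 mA2.
  exact: product_measure2E.
apply: eq_integral => v _ /=; congr (lebesgue_measure _).
by rewrite ysectionE.
Qed.

End lebesgue_rV_maps.

Section lebesgue_rV_linear.
Context {R : realType}.
Local Notation mu := (lebesgue_rV R).

Lemma measurable_rV_xsection n (B : set 'rV[R]_n.+1) (a : R) : measurable B ->
  measurable [set v : 'rV[R]_n | B (rV_cons (a, v))].
Proof.
move=> mB.
have mB' : measurable (@rV_cons R n @^-1` B).
  by apply: measurable_preimage => //; exact: measurable_rV_cons.
by have := measurable_xsection a mB'; rewrite xsectionE.
Qed.

Lemma measurable_rV_ysection n (B : set 'rV[R]_n.+1) (v : 'rV[R]_n) :
  measurable B -> measurable [set a : measurableTypeR R | B (rV_cons (a, v))].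
Proof.
move=> mB.
have mB' : measurable (@rV_cons R n @^-1` B).
  by apply: measurable_preimage => //; exact: measurable_rV_cons.
by have := measurable_ysection v mB'; rewrite ysectionE.
Qed.

(** Slicing reduces a map that fixes the first coordinate to its action on the fibres. Together with
    its counterpart for the other coordinates it yields the translations and the triangular block
    matrices. *)
Lemma measure_preimage_rV_cons1 n (k : R) (F : 'rV[R]_n.+1 -> 'rV[R]_n.+1)
    (g : R -> 'rV[R]_n -> 'rV[R]_n) :
  0 <= k -> measurable_fun setT F ->
  (forall a v, F (rV_cons (a, v)) = rV_cons (a, g a v)) ->
  (forall a C, measurable C -> (k%:E * mu n (g a @^-1` C) = mu n C)%E) ->
  forall B, measurable B -> (k%:E * mu n.+1 (F @^-1` B) = mu n.+1 B)%E.
Proof.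
move=> k0 mF Fg gC B mB; rewrite !lebesgue_rVS1 -ge0_integralZl//; last first.
  have mFB : measurable (@rV_cons R n @^-1` (F @^-1` B)).
    apply: measurable_preimage; first exact: measurable_rV_cons.
    exact: measurable_preimage.
  have := measurable_fun_xsection [the {sigma_finite_measure set _ -> \bar R} of mu n] mFB.
  apply: eq_measurable_fun => a _ /=; by rewrite xsectionE.
apply: eq_integral => a _.
rewrite -(gC a _ (measurable_rV_xsection a mB)); congr (_ * mu n _)%E.
by apply/seteqP; split => v /=; rewrite Fg.
Qed.

Lemma measure_preimage_rV_cons2 n (k : R) (F : 'rV[R]_n.+1 -> 'rV[R]_n.+1)
    (g : 'rV[R]_n -> R -> R) :
  0 <= k -> measurable_fun setT F ->
  (forall a v, F (rV_cons (a, v)) = rV_cons (g v a, v)) ->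
  (forall v (C : set (measurableTypeR R)), measurable C ->
     (k%:E * lebesgue_measure (g v @^-1` C) = lebesgue_measure C)%E) ->
  forall B, measurable B -> (k%:E * mu n.+1 (F @^-1` B) = mu n.+1 B)%E.
Proof.
move=> k0 mF Fg gC B mB.
have mFB := measurable_preimage mF mB.
rewrite !lebesgue_rVS2// -ge0_integralZl//; last first.
  have mFB' : measurable (@rV_cons R n @^-1` (F @^-1` B)).
    by apply: measurable_preimage => //; exact: measurable_rV_cons.
  have := measurable_fun_ysection
    [the {sigma_finite_measure set _ -> \bar R} of @lebesgue_measure R] mFB'.
  by apply: eq_measurable_fun => v _ /=; rewrite ysectionE.
apply: eq_integral => v _.
rewrite -(gC v _ (measurable_rV_ysection v mB)).
by congr (_ * lebesgue_measure _)%E; apply/seteqP; split => a /=; rewrite Fg.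
Qed.

Lemma rV_cons_row_mx n (a : R) (v : 'rV[R]_n) :
  rV_cons (a, v) = row_mx (a%:M : 'M[R]_1) v :> 'rV[R]_(1 + n).
Proof.
apply/rowP => i; rewrite !mxE; case: splitP => j ij.
  rewrite (_ : i = ord0) ?unlift_none ?ord1 ?mxE ?mulr1n//.
  by apply/val_inj; rewrite /= ij ord1.
rewrite (_ : i = lift ord0 j) ?liftK//.
by apply/val_inj; rewrite /= ij.
Qed.

Lemma rV_consP n (x : 'rV[R]_n.+1) : exists a v, x = rV_cons (a, v).
Proof.
exists (x 0 ord0), (\row_j x 0 (lift ord0 j)); apply/rowP => i; rewrite mxE /=.
by case: unliftP => [j|] ->; rewrite ?mxE.
Qed.

Lemma rV_consD n a b (v w : 'rV[R]_n) :
  rV_cons (a, v) + rV_cons (b, w) = rV_cons (a + b, v + w).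
Proof. by apply/rowP => i; rewrite !mxE /=; case: unlift => // j; rewrite mxE. Qed.

Lemma lebesgue_rV_shift n (w : 'rV[R]_n) (B : set 'rV[R]_n) : measurable B ->
  mu n ((fun x => x + w) @^-1` B) = mu n B.
Proof.
elim: n w B => [|n IHn] w B mB.
  congr (lebesgue_rV _ _ _).
  by apply/seteqP; split => x /=; rewrite !(thinmx0 x) !(thinmx0 w) addr0.
have [s [w' ->]] := rV_consP w.
pose F1 (x : 'rV[R]_n.+1) := x + rV_cons (0, w').
pose F2 (x : 'rV[R]_n.+1) := x + rV_cons (s, 0).
have mF2 : measurable (F2 @^-1` B).
  by apply: measurable_preimage => //; exact: measurable_shift_rV.
rewrite (_ : _ @^-1` B = F1 @^-1` (F2 @^-1` B)); last first.
  by apply/seteqP; split => x /=; rewrite /F1 /F2 -addrA rV_consD add0r addr0.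
rewrite -[LHS]mul1e (measure_preimage_rV_cons1 (g := fun _ v => v + w')) //.
- rewrite -[LHS]mul1e (measure_preimage_rV_cons2 (g := fun _ a => a * 1 + s)) //.
  + exact: measurable_shift_rV.
  + by move=> a v; rewrite /F2 rV_consD addr0 mulr1.
  + move=> v C mC; rewrite -[in RHS](@lebesgue_measure_affine R 1 s)//.
    by rewrite normr1.
- exact: measurable_shift_rV.
- by move=> a v; rewrite /F1 rV_consD addr0.
- by move=> a C mC; rewrite mul1e IHn.
Qed.

Let scales n (T : 'M[R]_n) := forall B : set 'rV[R]_n, measurable B ->
  (`|\det T|%:E * mu n ((fun x => x *m T) @^-1` B) = mu n B)%E.

Let scalesM n (S T : 'M[R]_n) : scales S -> scales T -> scales (S *m T).
Proof.
move=> hS hT B mB; rewrite det_mulmx normrM mulrC EFinM -muleA.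
rewrite (_ : _ @^-1` B = (fun x => x *m S) @^-1` ((fun x => x *m T) @^-1` B)).
  rewrite hS ?hT//; apply: measurable_preimage => //; exact: measurable_mulmxr.
by apply/seteqP; split => x /=; rewrite mulmxA.
Qed.

Let blk n (t : R) (r : 'rV[R]_n) (c : 'cV[R]_n) (S : 'M[R]_n) : 'M[R]_n.+1 :=
  block_mx (t%:M : 'M[R]_1) r c S.

Let rV_cons_mul n a (v : 'rV[R]_n) (t : R) (r : 'rV[R]_n) (c : 'cV[R]_n)
    (S : 'M[R]_n) :
  rV_cons (a, v) *m blk t r c S =
  rV_cons (a * t + (v *m c) 0 0, a *: r + v *m S).
Proof.
rewrite !rV_cons_row_mx; etransitivity; first exact:
  (@mul_row_block R 1 1 n 1 n a%:M v t%:M r c S).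
by rewrite -scalar_mxM mul_scalar_mx raddfD /= -mx11_scalar.
Qed.

Let scales_ublock n (r : 'rV[R]_n) (S : 'M[R]_n) : scales S ->
  scales (blk 1 r 0 S).
Proof.
move=> hS; rewrite /scales.
have -> : \det (blk 1 r 0 S) = \det S.
  by etransitivity; [exact: (@det_ublock R 1 n 1%:M r S)|rewrite det1 mul1r].
apply: (measure_preimage_rV_cons1 (g := fun a v => v *m S + a *: r)) => //.
- exact: measurable_mulmxr.
- by move=> a v; rewrite rV_cons_mul mulmx0 mxE mulr1 addr0 addrC.
- move=> a C mC.
  rewrite -(lebesgue_rV_shift (a *: r) mC) -[RHS]hS//.
  by apply: measurable_preimage => //; exact: measurable_shift_rV.
Qed.

Let scales_lblock n (t : R) (c : 'cV[R]_n) : t != 0 -> scales (blk t 0 c 1%:M).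
Proof.
move=> t0; rewrite /scales.
have -> : \det (blk t 0 c 1%:M) = t.
  by etransitivity; [exact: (@det_lblock R 1 n t%:M c 1%:M)|rewrite det1 mulr1 det_scalar1].
apply: (measure_preimage_rV_cons2 (g := fun v a => a * t + (v *m c) 0 0)) => //.
- exact: measurable_mulmxr.
- by move=> a v; rewrite rV_cons_mul scaler0 add0r mulmx1.
- by move=> v C mC; rewrite lebesgue_measure_affine.
Qed.

Let blkM n (t : R) (c : 'cV[R]_n) (r : 'rV[R]_n) (S : 'M[R]_n) :
  blk t 0 c 1%:M *m blk 1 r 0 S = blk t (t *: r) c (c *m r + S).
Proof.
etransitivity; first exact: (@mulmx_block R 1 n 1 n 1 n).
by rewrite !mulmx0 !mul1mx !mulmx1 !addr0 mul0mx addr0 mul_scalar_mx.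
Qed.

Let blk_upper n (r r' : 'rV[R]_n) : blk 1 r 0 1%:M *m blk 1 r' 0 1%:M =
  blk 1 (r' + r) 0 1%:M.
Proof.
etransitivity; first exact: (@mulmx_block R 1 n 1 n 1 n).
by rewrite !mulmx0 !mul1mx !mulmx1 !addr0 mul0mx add0r.
Qed.

Let blk1 n : blk 1 0 0 1%:M = 1%:M :> 'M[R]_n.+1.
Proof. by rewrite [RHS](@scalar_mx_block _ 1 n). Qed.

Let blkE n (T : 'M[R]_n.+1) : T = blk (T 0 0) (\row_j T 0 (lift 0 j))
  (\col_i T (lift 0 i) 0) (\matrix_(i, j) T (lift 0 i) (lift 0 j)).
Proof.
have e1 : @ulsubmx _ 1 n 1 n T = (T 0 0)%:M.
  apply/matrixP => i j; rewrite !ord1 !mxE mulr1n.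
  by congr (T _ _); apply/val_inj.
have e2 : @ursubmx _ 1 n 1 n T = \row_j T 0 (lift 0 j).
  by apply/matrixP => i j; rewrite ord1 !mxE; congr (T _ _); apply/val_inj.
have e3 : @dlsubmx _ 1 n 1 n T = \col_i T (lift 0 i) 0.
  by apply/matrixP => i j; rewrite ord1 !mxE; congr (T _ _); apply/val_inj.
have e4 : @drsubmx _ 1 n 1 n T = \matrix_(i, j) T (lift 0 i) (lift 0 j).
  by apply/matrixP => i j; rewrite !mxE; congr (T _ _); apply/val_inj.
by rewrite -[LHS](@submxK _ 1 n 1 n) e1 e2 e3 e4.
Qed.

(* T = [1 -r; 0 1] [t 0; c 1] [1 r'; 0 S], where r only serves to make the pivot t nonzero. *)
Lemma lebesgue_rV_mulmx n (T : 'M[R]_n) (B : set 'rV[R]_n) :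
  T \in unitmx -> measurable B ->
  (`|\det T|%:E * mu n ((fun x => (x *m T)%R) @^-1` B) = mu n B)%E.
Proof.
move=> uT; move: B; rewrite -/(scales T).
elim: n T uT => [|n IHn] T uT.
  move=> B mB; rewrite det_mx00 normr1 mul1e; congr (lebesgue_rV _ _ _).
  by apply/seteqP; split => x /=; rewrite (thinmx0 x) (thinmx0 (_ *m T)).
have pivot (T' : 'M[R]_n.+1) : T' \in unitmx -> T' 0 0 != 0 -> scales T'.
  rewrite {1 3}(blkE T'); set t := T' 0 0; set r := \row_j _; set c := \col_i _.
  set S := \matrix_(i, j) _ => uT' t0.
  have TE : blk t r c S = blk t 0 c 1%:M *m blk 1 (t^-1 *: r) 0 (S - t^-1 *: (c *m r)).
    by rewrite blkM scalerA mulfV// scale1r -scalemxAr addrC subrK.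
  have uS : S - t^-1 *: (c *m r) \in unitmx.
    move: uT'; rewrite TE unitmx_mul => /andP[_]; rewrite !unitmxE.
    congr (_ \is a _); etransitivity; first exact: (@det_ublock R 1 n).
    by rewrite det1 mul1r.
  rewrite TE; apply: scalesM; first exact: scales_lblock.
  exact: scales_ublock (IHn _ uS).
have [k Tk0] : exists k, T k 0 != 0.
  apply/existsP; rewrite -negb_forall; apply/negP => /forallP T0.
  move: uT; rewrite unitmxE unitfE (expand_det_col T 0) big1 ?eqxx// => i _.
  by rewrite (eqP (T0 i)) mul0r.
have [T00|T00] := eqVneq (T 0 0) 0; last exact: pivot.
have [k' kE|kE] := unliftP 0 k; last by rewrite kE T00 eqxx in Tk0.
(* Adding row [k], divided by [T k 0], to the first row turns the vanishing pivot into 1. *)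
pose r : 'rV[R]_n := (T k 0)^-1 *: delta_mx 0 k'.
pose E r := @blk n 1 r 0 1%:M.
have sE r' : scales (E r') by apply: scales_ublock; apply: IHn; exact: unitmx1.
have EE : E (- r) *m E r = 1%:M by rewrite blk_upper subrr blk1.
rewrite -[T]mul1mx -EE -mulmxA; apply: scalesM => //; apply: pivot.
  by rewrite unitmx_mul uT andbT; have := mulmx1_unit EE => -[].
have Er j : E r 0 (lift 0 j) = r 0 j.
  rewrite -[RHS](@block_mxEur R 1 n 1 n 1%:M r 0 1%:M) /E /blk.
  by congr (block_mx (n1 := 1) _ _ _ _ _ _); apply/val_inj.
rewrite mxE big_ord_recl T00 mulr0 add0r (bigD1 k') //= big1 => [|j jk'].
  by rewrite Er !mxE !eqxx mulr1 -kE addr0 mulVf ?oner_neq0.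
by rewrite Er !mxE (negbTE jk') andbF mulr0 mul0r.
Qed.

End lebesgue_rV_linear.

(** * Measurability of open and compact sets; cubes *)

Section borel_rV.
Context {R : realType}.
Local Notation mu := (lebesgue_rV R).

Lemma nbhs_rVP n (A : set 'rV[R]_n) (x : 'rV[R]_n) :
  nbhs x A <-> exists2 e : R, 0 < e &
    forall y : 'rV[R]_n, (forall i, `|x 0 i - y 0 i| < e) -> A y.
Proof.
split.
  move=> /nbhs_ballP[e e0 eA]; exists e => // y xy; apply: eA; split => // i j.
  by rewrite ord1; exact: xy.
move=> [e e0 eA]; apply/nbhs_ballP; exists e => // y [_ xy]; apply: eA => i.
exact: xy.
Qed.

Lemma measurable_box n (A : 'I_n -> set (measurableTypeR R)) :
  (forall i, measurable (A i)) ->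
  measurable [set x : 'rV[R]_n | forall i, A i (x 0 i)].
Proof.
move=> mA; rewrite (_ : [set _ | _] =
    \bigcap_(i in [set: 'I_n]) (coord_rV i @^-1` A i)).
  apply: fin_bigcap_measurable => // i _; apply: measurable_preimage => //.
  exact: measurable_coord_rV.
by apply/seteqP; split => x /= xA i; [move=> _; exact: xA|exact: (xA i I)].
Qed.

(** An open set is the union of the countably many boxes with rational centre and radius 1/(k + 1)
    that it contains. *)
Lemma open_measurable_rV n (A : set 'rV[R]_n) : open A -> measurable A.
Proof.
move=> oA.
pose box (qk : 'rV[rat]_n * nat) : set 'rV[R]_n :=
  [set x | forall i, `](ratr (qk.1 0 i) - qk.2.+1%:R^-1)%R,
                       (ratr (qk.1 0 i) + qk.2.+1%:R^-1)%R[%classic (x 0 i)].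
pose F qk := if `[< box qk `<=` A >] then box qk else set0.
rewrite (_ : A = \bigcup_qk F qk).
  apply: countable_bigcupT_measurable; first exact: countableP.
  move=> qk; rewrite /F; case: ifP => // _.
  apply: (@measurable_box n (fun i => `](ratr (qk.1 0 i) - qk.2.+1%:R^-1)%R,
                       (ratr (qk.1 0 i) + qk.2.+1%:R^-1)%R[%classic)) => i.
  exact: measurable_itv.
apply/seteqP; split=> [x Ax|x [qk _]]; last first.
  by rewrite /F; case: ifPn => // /asboolP; apply.
have /nbhs_rVP[e e0 eA] : nbhs x A by exact: open_nbhs_nbhs.
have [k ke] : exists k : nat, k.+1%:R^-1 < e / 2.
  have e20 : 0 < e / 2 by rewrite divr_gt0.
  exists (Num.truncn (e / 2)^-1).
  by rewrite invf_plt ?posrE// truncnS_gt.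
have k0 : 0 < k.+1%:R^-1 :> R by rewrite invr_gt0.
have /choice[q qP] (i : 'I_n) : exists q : rat,
    ratr q \in `](x 0 i - k.+1%:R^-1)%R, (x 0 i + k.+1%:R^-1)%R[.
  by apply: rat_in_itvoo; rewrite ltrBlDr -addrA ltrDl addr_gt0.
exists ((\row_i q i), k) => //; rewrite /F ifT.
  move=> i /=; rewrite in_itv /= mxE; have := qP i; rewrite in_itv /= => /andP[h1 h2]. 
  by rewrite ltrBlDr h2 -ltrBlDr h1.
apply/asboolP => y yb; apply: eA => i.
have := yb i; rewrite /= in_itv /= mxE => /andP[h1 h2].
have := qP i; rewrite in_itv /= => /andP[h3 h4].
move: k0 ke h1 h2 h3 h4; move: (k.+1%:R^-1 : R) => r *.
by rewrite ltr_norml; apply/andP; split; lra.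
Qed.

Lemma closed_measurable_rV n (A : set 'rV[R]_n) : closed A -> measurable A.
Proof.
by move=> /closed_openC/open_measurable_rV/measurableC; rewrite setCK.
Qed.

Lemma compact_closed_rV n (A : set 'rV[R]_n) : compact A -> closed A.
Proof. by apply: compact_closed; exact: norm_hausdorff. Qed.

Lemma compact_measurable_rV n (A : set 'rV[R]_n) : compact A -> measurable A.
Proof. by move=> /compact_closed_rV/closed_measurable_rV. Qed.

Lemma within_continuous_measurable_rV n (A : set 'rV[R]_n) (f : 'rV[R]_n -> R) :
  measurable A -> {within A, continuous f} -> measurable_fun A f.
Proof.
move=> mA /continuousP cf; apply: (measurability _ (RGenOpens.measurableE R)).
move=> /= _ [_ [a [b ->] <-]].
have /open_subspaceP[U oU UA] := cf _ (@interval_open R (BRight a) (BLeft b) erefl erefl).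
rewrite setIC -UA; apply: measurableI => //; exact: open_measurable_rV.
Qed.

Lemma cubeE n (c : 'rV[R]_n) (r : R) :
  [set x : 'rV[R]_n | forall i, `|x 0 i - c 0 i| <= r] =
  [set x : 'rV[R]_n | forall i, `[(c 0 i - r)%R, (c 0 i + r)%R]%classic (x 0 i)].
Proof.
by apply/seteqP; split => x /= xr i; move: (xr i); rewrite in_itv /= ler_distl.
Qed.

Lemma lebesgue_cube n (c : 'rV[R]_n) (r : R) : 0 <= r ->
  mu n [set x : 'rV[R]_n | forall i, `|x 0 i - c 0 i| <= r] = ((2 * r) ^+ n)%:E.
Proof.
move=> r0; rewrite cubeE.
rewrite (lebesgue_rV_box (A := fun i => `[(c 0 i - r)%R, (c 0 i + r)%R]%classic)).
  rewrite (eq_bigr (fun=> (2 * r)%:E)).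
    by rewrite prodEFin prodr_const card_ord.
  move=> i _; rewrite lebesgue_measure_itv /= lte_fin.
  case: ltP => h; first by rewrite -EFinD; congr EFin; lra.
  by congr EFin; lra.
by move=> i; exact: measurable_itv.
Qed.

Lemma measurable_cube n (c : 'rV[R]_n) (r : R) :
  measurable [set x : 'rV[R]_n | forall i, `|x 0 i - c 0 i| <= r].
Proof.
rewrite cubeE.
apply: (@measurable_box n (fun i => `[(c 0 i - r)%R, (c 0 i + r)%R]%classic)) => i.
exact: measurable_itv.
Qed.

End borel_rV.

(** * Convex bodies and determinants of their points *)

Section convex_bodies.
Context {R : realType} {n : nat}.
Implicit Types (K : set 'rV[R]_n) (x y : 'rV[R]_n).

Lemma convex_setP K : convex_set K <->
  forall x y (a : R), K x -> K y -> 0 <= a <= 1 -> K (a *: x + (1 - a) *: y).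
Proof.
split=> [cK x y a Kx Ky /andP[a0 a1]|cK x y l /set_mem Kx /set_mem Ky].
  exact/set_mem/(cK x y (Itv01 a0 a1) (mem_set Kx) (mem_set Ky)).
by apply/mem_set; apply: cK => //; apply/andP; split.
Qed.

Lemma convex_sum K m (t : 'I_m -> R) (x : 'I_m -> 'rV[R]_n) :
  convex_set K -> K 0 -> (forall j, 0 <= t j) -> \sum_j t j <= 1 ->
  (forall j, K (x j)) -> K (\sum_j t j *: x j).
Proof.
move=> /convex_setP cK K0; elim: m t x => [|m IHm] t x t0 t1 xK.
  by rewrite big_ord0.
move: t1; rewrite !big_ord_recl => t1.
have s0 : 0 <= \sum_(i < m) t (lift ord0 i) by exact: sumr_ge0.
have [t1'|t1'] := eqVneq (t ord0) 1.
  rewrite big1 ?addr0 ?t1' ?scale1r// => i _.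
  have /eqP : \sum_(i < m) t (lift ord0 i) = 0 by lra.
  by rewrite psumr_eq0// => /allP/(_ i (mem_index_enum i))/eqP ->; rewrite scale0r.
have t10 : 0 < 1 - t ord0 by move/eqP: t1' => t1'; have := t0 ord0; lra.
have -> : \sum_(i < m) t (lift ord0 i) *: x (lift ord0 i) = (1 - t ord0) *:
    \sum_(i < m) (t (lift ord0 i) / (1 - t ord0)) *: x (lift ord0 i).
  rewrite scaler_sumr; apply: eq_bigr => i _.
  by rewrite scalerA mulrC divfK// gt_eqF.
apply: cK => //; last by rewrite t0 /=; lra.
apply: IHm => //.
  by move=> j; rewrite divr_ge0// ltW.
by rewrite -mulr_suml ler_pdivrMr// mul1r; lra.
Qed.

Lemma symmetricP K x : centrally_symmetric K -> K x -> K (- x).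
Proof. by move=> sK Kx; rewrite -sK; exists x. Qed.

Lemma symmetric_convex0 K : convex_set K -> centrally_symmetric K ->
  K !=set0 -> K 0.
Proof.
move=> /convex_setP cK sK [x Kx].
have -> : 0 = 2^-1 *: x + (1 - 2^-1) *: - x :> 'rV[R]_n.
  by rewrite scalerN -scaleNr -scalerDl (_ : _ + _ = 0) ?scale0r//; lra.
by apply: cK => //; [exact: symmetricP|apply/andP; split; lra].
Qed.

(** The cube [0, 1/n]^n consists of coefficient vectors of sum at most 1, so K contains its linear
    image, of volume |det| / n^n. The full simplex would give 1 / n! in place of 1 / n^n, which
    changes only absolute constants. *)
Lemma det_le_volume K (x : 'I_n -> 'rV[R]_n) : (0 < n)%N -> compact K ->
  convex_set K -> K 0 -> (forall j, K (x j)) ->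
  (`|\det (\matrix_j x j)|%:E <= (n%:R ^+ n)%:E * vol K)%E.
Proof.
move=> n0 kK cK K0 xK; set T := \matrix_j x j.
have nR0 : 0 < n%:R :> R by rewrite ltr0n.
have mK := compact_measurable_rV kK.
have [->|dT] := eqVneq (\det T) 0.
  by rewrite normr0 mule_ge0//; exact: measure_ge0.
have uT : T \in unitmx by rewrite unitmxE unitfE.
rewrite /vol -(lebesgue_rV_mulmx uT mK) muleCA -[leLHS]mule1.
rewrite lee_pmul2l ?lte_fin ?normr_gt0//.
pose c : 'rV[R]_n := const_mx (2 * n%:R)^-1.
have cn : (2 * n%:R)^-1 * n%:R = 2^-1 :> R by field; rewrite gt_eqF.
have <- : ((n%:R ^+ n)%:E * lebesgue_rV R n
    [set t : 'rV[R]_n | forall i, (`|t 0 i - c 0 i| <= (2 * n%:R)^-1)%R])%E = 1%E.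
  rewrite lebesgue_cube ?invr_ge0 ?mulr_ge0//= -EFinM -exprMn.
  by rewrite mulrCA [n%:R * _]mulrC cn divff// expr1n.
apply: lee_wpmul2l; first by rewrite lee_fin exprn_ge0.
apply: le_measure.
- apply/mem_set; exact: (measurable_cube c).
- by apply/mem_set; apply: measurable_preimage => //; exact: measurable_mulmxr.
move=> t tc /=.
have -> : t *m T = \sum_j t 0 j *: x j.
  apply/rowP => k; rewrite mxE summxE; apply: eq_bigr => j _.
  by rewrite !mxE.
have t_itv j : 0 <= t 0 j <= 2 * (2 * n%:R)^-1.
  by have := tc j; rewrite /c mxE ler_distl => /andP[h1 h2]; apply/andP; split; lra.
apply: convex_sum => //; first by move=> j; case/andP: (t_itv j).
apply: (@le_trans _ _ (\sum_(j < n) 2 * (2 * n%:R)^-1)).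
  by apply: ler_sum => j _; case/andP: (t_itv j).
by rewrite sumr_const card_ord -[leLHS]mulr_natr -mulrA cn; lra.
Qed.

(** The midpoints between - x0 and a neighbourhood of an interior point x0 fill a neighbourhood of
    0, which contains small multiples of the basis vectors. *)
Lemma convex_body_full K : convex_body K -> centrally_symmetric K ->
  exists x : 'I_n -> 'rV[R]_n, (forall j, K (x j)) /\ \det (\matrix_j x j) != 0.
Proof.
move=> [_ /convex_setP cK [x0 /nbhs_rVP[e e0 eK]]] sK.
exists (fun j => (e / 4) *: delta_mx 0 j); split.
  move=> j.
  have -> : (e / 4) *: delta_mx 0 j = 2^-1 *: (x0 + (e / 2) *: delta_mx 0 j) +
      (1 - 2^-1) *: - x0.
    rewrite scalerDr scalerA addrAC scalerN -scaleNr -scalerDl.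
    rewrite (_ : 2^-1 + _ = 0) ?scale0r ?add0r; last by lra.
    by congr (_ *: _); lra.
  apply: cK; last by apply/andP; split; lra.
    apply: eK => i; rewrite !mxE eqxx /= opprD addNKr normrN.
    by case: (_ == _); rewrite ?mulr1 ?mulr0 ?normr0// gtr0_norm; lra.
  apply: symmetricP => //; apply: eK => i.
  by rewrite subrr normr0.
rewrite (_ : \matrix_j _ = (e / 4)%:M).
  by rewrite det_scalar expf_neq0// gt_eqF// divr_gt0.
by apply/matrixP => i j; rewrite !mxE eqxx /= eq_sym mulr_natr.
Qed.

End convex_bodies.

(** * Rademacher sums, as sums over all sign vectors *)

Section rademacher.
Context {R : realType}.

Definition rsum N (a : 'I_N -> R) (e : {ffun 'I_N -> bool}) : R :=
  \sum_i (-1) ^+ e i * a i.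

Lemma rsum_recl N (a : 'I_N.+1 -> R) (F : R -> R) :
  \sum_e F (rsum a e) =
  \sum_(e : {ffun 'I_N -> bool})
    (F (a ord0 + rsum (a \o lift ord0) e) + F (- a ord0 + rsum (a \o lift ord0) e)).
Proof.
pose h (be : bool * {ffun 'I_N -> bool}) : {ffun 'I_N.+1 -> bool} :=
  [ffun i => if unlift ord0 i is Some j then be.2 j else be.1].
pose h' (e : {ffun 'I_N.+1 -> bool}) := (e ord0, [ffun j => e (lift ord0 j)]).
have hK : cancel h h'.
  move=> [b e]; rewrite /h' /h ffunE unlift_none; congr pair.
  by apply/ffunP => j; rewrite !ffunE liftK.
have h'K : cancel h' h.
  by move=> e; apply/ffunP => i; rewrite ffunE; case: unliftP => [j|] -> //=; rewrite ffunE.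
rewrite (reindex h) /=; last by apply: onW_bij; exists h'.
have hE b e : rsum a (h (b, e)) = (-1) ^+ b * a ord0 + rsum (a \o lift ord0) e.
  rewrite /rsum big_ord_recl ffunE unlift_none /=; congr (_ + _).
  by apply: eq_bigr => j _; rewrite ffunE liftK.
rewrite -(pair_big xpredT xpredT (fun b e => F (rsum a (h (b, e))))) /= exchange_big /=.
apply: eq_bigr => e _; rewrite big_bool !hE expr1 mulN1r expr0 mul1r.
exact: addrC.
Qed.

Lemma card_signs N : #|{ffun 'I_N -> bool}|%:R = 2 ^+ N :> R.
Proof. by rewrite card_ffun card_bool card_ord natrX. Qed.

Lemma sum_signs_const N (c : R) :
  \sum_(e : {ffun 'I_N -> bool}) c = 2 ^+ N * c.
Proof. by rewrite sumr_const -card_signs mulr_natl. Qed.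

Let rsum0 (a : 'I_0 -> R) e : rsum a e = 0.
Proof. by rewrite /rsum big_ord0. Qed.

Lemma rsum_moment2 N (a : 'I_N -> R) :
  \sum_e rsum a e ^+ 2 = 2 ^+ N * \sum_i a i ^+ 2.
Proof.
elim: N a => [|N IHN] a.
  by rewrite big_ord0 mulr0 big1// => e _; rewrite rsum0 expr0n.
rewrite (rsum_recl a (fun x => x ^+ 2)).
rewrite (eq_bigr (fun e => 2 * a ord0 ^+ 2 +
  2 * rsum (a \o lift ord0) e ^+ 2)); last by move=> e _; ring.
rewrite big_split /= sum_signs_const -mulr_sumr IHN big_ord_recl (exprS 2 N).
by rewrite /=; ring.
Qed.

Lemma rsum_moment4 N (a : 'I_N -> R) :
  \sum_e rsum a e ^+ 4 <= 2 ^+ N * (3 * (\sum_i a i ^+ 2) ^+ 2).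
Proof.
elim: N a => [|N IHN] a.
  by rewrite big_ord0 expr0n !mulr0 big1// => e _; rewrite rsum0 expr0n.
rewrite (rsum_recl a (fun x => x ^+ 4)).
rewrite (eq_bigr (fun e => 2 * a ord0 ^+ 4 + (12 * a ord0 ^+ 2) *
  rsum (a \o lift ord0) e ^+ 2 + 2 * rsum (a \o lift ord0) e ^+ 4)); last first.
  by move=> e _; ring.
rewrite !big_split /= sum_signs_const -!mulr_sumr rsum_moment2 big_ord_recl /=.
have := IHN (a \o lift ord0); rewrite /=.
set s := \sum_i _ ^+ 2; set q := \sum_e _ => qs.
have : 0 <= 2 ^+ N * a ord0 ^+ 4 :> R.
  by apply: mulr_ge0; [exact: exprn_ge0|exact: exprn_even_ge0].
rewrite (exprS 2 N); lra.
Qed.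

(** The exponent 2 x^2 in place of the sharp x^2 / 2 permits a proof from 1 + y <= exp y alone: for
    0 <= x <= 1/2 through 1 / (1 - x) <= 1 + x + 2 x^2 and 1 / (1 + x) <= 1 - x + 2 x^2, for x > 1/2
    from x <= 2 x^2. *)
Lemma cosh_le (x : R) : expR x + expR (- x) <= 2 * expR (2 * x ^+ 2).
Proof.
wlog x0 : x / 0 <= x => [H|].
  have [/H//|/ltW x0] := leP 0 x.
  by have := H (- x); rewrite opprK sqrrN oppr_ge0 addrC; apply.
have [xs|xb] := leP x (1/2).
  have h1 : expR x <= 1 + x + 2 * x ^+ 2.
    have h0 : 0 < 1 - x by lra.
    rewrite -[x in expR x]opprK expRN invf_ple ?posrE ?expR_gt0//; last first.
      by have := sqr_ge0 x; lra.
    apply: le_trans (expR_ge1Dx (- x)).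
    rewrite invf_ple ?posrE//; last by have := sqr_ge0 x; lra.
    rewrite -[leLHS]mul1r ler_pdivrMr//.
    have : 0 <= x ^+ 2 * (1 - 2 * x) by rewrite mulr_ge0 ?sqr_ge0//; lra.
    by rewrite !expr2; lra.
  have h2 : expR (- x) <= 1 - x + 2 * x ^+ 2.
    have h0 : 0 < 1 + x by lra.
    rewrite expRN; apply: (@le_trans _ _ (1 + x)^-1).
      by rewrite lef_pV2 ?posrE ?expR_gt0// expR_ge1Dx.
    rewrite -[leLHS]mul1r ler_pdivrMr//.
    have : 0 <= x ^+ 2 * (1 + 2 * x) by rewrite mulr_ge0 ?sqr_ge0//; lra.
    by rewrite !expr2; lra.
  by have := expR_ge1Dx (2 * x ^+ 2); lra.
have : expR x <= expR (2 * x ^+ 2) by rewrite ler_expR expr2; nra.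
have : expR (- x) <= expR (2 * x ^+ 2) by rewrite ler_expR expr2; nra.
lra.
Qed.

Lemma rsum_mgf N (a : 'I_N -> R) (l : R) :
  \sum_e expR (l * rsum a e) <= 2 ^+ N * expR (2 * l ^+ 2 * \sum_i a i ^+ 2).
Proof.
elim: N a => [|N IHN] a.
  rewrite big_ord0 mulr0 expR0 mulr1 expr0.
  rewrite (eq_bigr (fun=> 1)) => [|e _]; last by rewrite rsum0 mulr0 expR0.
  by rewrite sum_signs_const expr0 mulr1.
rewrite (rsum_recl a (fun x => expR (l * x))).
rewrite (eq_bigr (fun e => (expR (l * a ord0) + expR (- (l * a ord0))) *
  expR (l * rsum (a \o lift ord0) e))); last first.
  by move=> e _; rewrite mulrDr mulrDr mulrN !expRD mulrDl.
rewrite -mulr_sumr big_ord_recl mulrDr expRD (exprS 2 N).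
have -> : 2 * l ^+ 2 * a ord0 ^+ 2 = 2 * (l * a ord0) ^+ 2 by ring.
rewrite [leRHS](_ : _ = (2 * expR (2 * (l * a ord0) ^+ 2)) *
  (2 ^+ N * expR (2 * l ^+ 2 * \sum_(i < N) a (lift ord0 i) ^+ 2))); last by ring.
apply: ler_pM (cosh_le _) (IHN _).
  by rewrite addr_ge0 ?expR_ge0.
by apply: sumr_ge0 => e _; exact: expR_ge0.
Qed.

Lemma powR_le_expR (p t : R) : 0 < p -> 0 <= t -> t `^ p <= p `^ p * expR t.
Proof.
move=> p0 t0.
have tp0 : 0 <= t / p by rewrite divr_ge0// ltW.
have -> : expR t = expR (t / p) `^ p by rewrite -expRM divfK// gt_eqF.
rewrite (_ : t `^ p = p `^ p * (t / p) `^ p); last first.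
  by rewrite -powRM ?(ltW p0)// mulrC divfK// gt_eqF.
rewrite ler_wpM2l ?powR_ge0// ge0_ler_powR ?nnegrE ?(ltW p0) ?expR_ge0//.
by apply: le_trans (expR_ge1Dx _); rewrite lerDr.
Qed.

(* Khintchine's inequality with the sharp order sqrt p of the constant, from the Laplace
   transform at l = sqrt (p / tau). *)
Lemma rsum_khintchine N (a : 'I_N -> R) (p tau : R) : 0 < p -> 0 < tau ->
  \sum_i a i ^+ 2 <= tau ->
  \sum_e `|rsum a e| `^ p <= 2 ^+ N * (2 * (expR 2 * Num.sqrt (p * tau)) `^ p).
Proof.
move=> p0 tau0 atau.
pose l := Num.sqrt (p / tau).
have l0 : 0 < l by rewrite sqrtr_gt0 divr_gt0.
have l2 : l ^+ 2 * tau = p by rewrite sqr_sqrtr ?divfK ?gt_eqF// ltW// divr_gt0.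
have plE : p / l = Num.sqrt (p * tau).
  apply/eqP; rewrite eq_sym -(@eqrXn2 _ 2)//; last first.
    by rewrite divr_ge0// ltW.
  rewrite sqr_sqrtr ?mulr_ge0 ?ltW//; apply/eqP.
  by rewrite expr_div_n -l2; field; rewrite gt_eqF.
have bound e : `|rsum a e| `^ p <= (p / l) `^ p *
    (expR (l * rsum a e) + expR (- l * rsum a e)).
  have il0 : 0 <= l^-1 by rewrite invr_ge0 ltW.
  have lr0 : 0 <= l * `|rsum a e| by rewrite mulr_ge0// ltW.
  rewrite (_ : `|rsum a e| `^ p = (l * `|rsum a e|) `^ p * l^-1 `^ p); last first.
    by rewrite -(powRM _ lr0 il0) mulrAC mulfV ?mul1r// gt_eqF.
  rewrite (powRM _ (ltW p0) il0).
  rewrite -mulrA [X in _ <= _ * X]mulrC mulrA ler_wpM2r ?powR_ge0//.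
  apply: le_trans (powR_le_expR p0 lr0) _.
  rewrite ler_wpM2l ?powR_ge0//.
  have [r0|r0] := leP 0 (rsum a e).
    by rewrite ger0_norm// lerDl expR_ge0.
  by rewrite ltr0_norm// mulrN mulNr lerDr expR_ge0.
apply: le_trans (ler_sum _ (fun e _ => bound e)) _.
rewrite -mulr_sumr big_split /=.
have le_l k : k ^+ 2 = l ^+ 2 ->
    \sum_e expR (k * rsum a e) <= 2 ^+ N * expR (2 * p).
  move=> kl; apply: le_trans (rsum_mgf _ _) _.
  rewrite ler_wpM2l ?exprn_ge0// ler_expR kl -mulrA ler_wpM2l// -l2 ler_wpM2l//.
  exact: sqr_ge0.
have := le_l l erefl; have := le_l (- l) (sqrrN _).
set s1 := \sum_e _; set s2 := \sum_e _ => h1 h2.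
have -> : 2 ^+ N * (2 * (expR 2 * Num.sqrt (p * tau)) `^ p) =
    (p / l) `^ p * (2 ^+ N * expR (2 * p) + 2 ^+ N * expR (2 * p)).
  by rewrite plE powRM ?expR_ge0 ?sqrtr_ge0// expRM; ring.
by rewrite ler_wpM2l ?powR_ge0// lerD.
Qed.

End rademacher.

(** * Integrals against the weight f *)

Section weighted_integral.
Context d (T : measurableType d) (R : realType) (mu : {measure set T -> \bar R}).
Variables (D : set T) (f : T -> R).
Hypotheses (mD : measurable D) (muD : (mu D < +oo)%E).

(** On a set of finite measure these functions are integrable, and they are stable under the
    operations needed; this settles all integrability conditions at once. *)
Definition bmeas (g : T -> R) :=
  measurable_fun D g /\ exists B, forall x, D x -> `|g x| <= B.

Hypotheses (bf : bmeas f) (f0 : forall x, D x -> 0 <= f x).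

Definition wint (g : T -> R) : R := \int[mu]_(x in D) (g x * f x).

Lemma bmeas_cst c : bmeas (fun=> c).
Proof. by split => //; exists `|c|. Qed.

Lemma bmeasD g h : bmeas g -> bmeas h -> bmeas (fun x => g x + h x).
Proof.
move=> [mg [B gB]] [mh [C hC]]; split; first exact: measurable_funD.
by exists (B + C) => x Dx; apply: le_trans (ler_normD _ _) _; rewrite lerD ?gB ?hC.
Qed.

Lemma bmeasM g h : bmeas g -> bmeas h -> bmeas (fun x => g x * h x).
Proof.
move=> [mg [B gB]] [mh [C hC]]; split; first exact: measurable_funM.
by exists (B * C) => x Dx; rewrite normrM ler_pM ?gB ?hC.
Qed.

Lemma bmeas_sum (I : finType) (g : I -> T -> R) : (forall i, bmeas (g i)) ->
  bmeas (fun x => \sum_i g i x).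
Proof.
move=> bg; split; first by apply: measurable_sum => i; case: (bg i).
have /choice[B BP] i : exists B, forall x, D x -> `|g i x| <= B by case: (bg i).
exists (\sum_i B i) => x Dx; apply: le_trans (ler_norm_sum _ _ _) _.
by apply: ler_sum => i _; exact: BP.
Qed.

Lemma bmeas_powR g p : 0 <= p -> bmeas g -> bmeas (fun x => `|g x| `^ p).
Proof.
move=> p0 [mg [B gB]]; split.
  apply: (measurableT_comp (measurable_powR p)); exact: measurableT_comp.
exists (B `^ p) => x Dx; rewrite ger0_norm ?powR_ge0//.
by rewrite ge0_ler_powR ?nnegrE ?gB//; apply: le_trans (gB _ Dx).
Qed.

Lemma bmeas_integrable g : bmeas g -> mu.-integrable D (EFin \o g).
Proof.
move=> [mg [B gB]]; apply: measurable_bounded_integrable => //.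
exists B; split; first exact: num_real.
by move=> M BM x Dx; apply: le_trans (gB _ Dx) (ltW BM).
Qed.

Let wi g : bmeas g -> mu.-integrable D (EFin \o (fun x => g x * f x)).
Proof. by move=> bg; apply: bmeas_integrable; exact: bmeasM. Qed.

Lemma wintE g : bmeas g -> (\int[mu]_(x in D) (g x * f x)%:E)%E = (wint g)%:E.
Proof.
move=> bg; have fg := integrable_fin_num mD (wi bg).
by rewrite /wint /Rintegral fineK //; exact: fg.
Qed.

Lemma wint_ge0 g : (forall x, D x -> 0 <= g x) -> 0 <= wint g.
Proof. by move=> g0; apply: Rintegral_ge0 => x Dx; rewrite mulr_ge0 ?g0 ?f0. Qed.

Lemma le_wint g h : bmeas g -> bmeas h -> (forall x, D x -> g x <= h x) ->
  wint g <= wint h.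
Proof.
move=> bg bh gh; apply: le_Rintegral; [by []|exact: wi|exact: wi|].
by move=> x Dx; rewrite ler_wpM2r ?f0 ?gh.
Qed.

Lemma wintD g h : bmeas g -> bmeas h ->
  wint (fun x => g x + h x) = wint g + wint h.
Proof.
move=> bg bh; rewrite /wint -RintegralD //; [|exact: wi|exact: wi].
by apply: eq_Rintegral => x _; rewrite mulrDl.
Qed.

Lemma wintZ c g : bmeas g -> wint (fun x => c * g x) = c * wint g.
Proof.
move=> bg; rewrite /wint -RintegralZl //; last exact: wi.
by apply: eq_Rintegral => x _; rewrite mulrA.
Qed.

Lemma wint_cst c : wint (fun=> c) = c * wint (fun=> 1).
Proof.
rewrite -wintZ; last exact: bmeas_cst.
by apply: eq_Rintegral => x _; rewrite mulr1.
Qed.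

Lemma wint_sum (I : finType) (g : I -> T -> R) : (forall i, bmeas (g i)) ->
  wint (fun x => \sum_i g i x) = \sum_i wint (g i).
Proof.
move=> bg; apply: EFin_inj; rewrite -wintE; last exact: bmeas_sum.
rewrite -sumEFin.
rewrite (eq_bigr (fun i => \int[mu]_(x in D) (g i x * f x)%:E)%E); last first.
  by move=> i _; rewrite wintE.
rewrite -integral_sum//; last by move=> i; exact: wi.
by apply: eq_integral => x _; rewrite mulr_suml -sumEFin.
Qed.

(* Comparisons of the moments of order p and 1, 2 up to a factor c^p, which replace Jensen's
   inequality: t^p <= s^p (1 + (t/s)^2) for p <= 2 and t <= s + s (t/s)^p for p >= 1. *)
Lemma wint_powR_le2 g p s : 0 < s -> 1 <= p <= 2 -> bmeas g ->
  wint (fun x => `|g x| `^ 2) <= s ^+ 2 * wint (fun=> 1) ->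
  wint (fun x => `|g x| `^ p) <= (2 * s) `^ p * wint (fun=> 1).
Proof.
move=> s0 /andP[p1 p2] bg h2.
have J0 : 0 <= wint (fun=> 1) by apply: wint_ge0.
have bg2 : bmeas (fun x => `|g x| `^ 2) by apply: bmeas_powR.
have bgp : bmeas (fun x => `|g x| `^ p) by apply: bmeas_powR => //; lra.
apply: (@le_trans _ _ (s `^ p * (2 * wint (fun=> 1)))); last first.
  rewrite (powRM _ (ler0n R 2) (ltW s0)) [2 `^ p * _]mulrC -mulrA.
  rewrite ler_wpM2l ?powR_ge0// ler_wpM2r// -[leLHS]powRr1//.
  by rewrite ler_powR// ler1n.
apply: (@le_trans _ _ (wint (fun x => s `^ p * (1 + s ^- 2 * `|g x| `^ 2)))).
  apply: le_wint => //.
    by apply: bmeasM; [exact: bmeas_cst|apply: bmeasD; [exact: bmeas_cst|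
      apply: bmeasM => //; exact: bmeas_cst]].
  move=> x Dx; set t := `|g x|.
  have t0 : 0 <= t by exact: normr_ge0.
  rewrite [t `^ 2](_ : _ = t ^+ 2); last by rewrite -powR_mulrn.
  rewrite [t in t `^ p](_ : t = s * (t / s)); last by rewrite mulrC divfK// gt_eqF.
  have ts0 : 0 <= t / s by rewrite divr_ge0// ltW.
  rewrite (powRM _ (ltW s0) ts0) ler_wpM2l ?powR_ge0//.
  rewrite [_ * t ^+ 2](_ : _ = (t / s) ^+ 2); last by rewrite expr_div_n mulrC.
  have [ts1|ts1] := leP (t / s) 1.
    apply: (@le_trans _ _ 1); last by rewrite lerDl sqr_ge0.
    have : (t / s) `^ p <= 1 `^ p by rewrite ge0_ler_powR ?nnegrE//; lra.
    by rewrite powR1.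
  apply: (@le_trans _ _ ((t / s) ^+ 2)); last by rewrite lerDr.
  by rewrite -powR_mulrn// ler_powR// ltW.
rewrite wintZ; last first.
  by apply: bmeasD; [exact: bmeas_cst|apply: bmeasM => //; exact: bmeas_cst].
rewrite ler_wpM2l ?powR_ge0// wintD; [|exact: bmeas_cst|]; last first.
  by apply: bmeasM => //; exact: bmeas_cst.
rewrite wintZ// mulrDl mul1r lerD2l.
by rewrite mulrC ler_pdivrMr ?exprn_gt0// mulrC.
Qed.

Lemma wint_powR_ge1 g p s : 0 < s -> 1 <= p -> bmeas g ->
  2 * s * wint (fun=> 1) <= wint (fun x => `|g x|) ->
  s `^ p * wint (fun=> 1) <= wint (fun x => `|g x| `^ p).
Proof.
move=> s0 p1 bg h1.
have p0 : 0 <= p by lra.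
have bgp : bmeas (fun x => `|g x| `^ p) by exact: bmeas_powR.
have bg1 : bmeas (fun x => `|g x|).
  case: bg => [mg [B gB]]; split; first exact: measurableT_comp.
  by exists B => x Dx; rewrite normr_id gB.
have : wint (fun x => `|g x|) <= wint (fun x => s + s / s `^ p * `|g x| `^ p).
  apply: le_wint => //.
    by apply: bmeasD; [exact: bmeas_cst|apply: bmeasM => //; exact: bmeas_cst].
  move=> x Dx; set t := `|g x|.
  have t0 : 0 <= t by exact: normr_ge0.
  have [ts|st] := leP t s.
    by apply: le_trans ts _; rewrite lerDl mulr_ge0 ?powR_ge0// divr_ge0 ?powR_ge0// ltW.
  apply: (@le_trans _ _ (s / s `^ p * t `^ p)); last by rewrite lerDr ltW.
  have ts0 : 0 <= t / s by rewrite divr_ge0// ltW.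
  rewrite {2}(_ : t = s * (t / s)); last by rewrite mulrC divfK// gt_eqF.
  rewrite (powRM _ (ltW s0) ts0) mulrA divfK ?gt_eqF ?powR_gt0//.
  rewrite {1}(_ : t = s * (t / s)); last by rewrite mulrC divfK// gt_eqF.
  rewrite ler_pM2l// -{1}[t / s]powRr1// ler_powR//.
  by rewrite ler_pdivlMr// mul1r ltW.
rewrite wintD; [|exact: bmeas_cst|]; last first.
  by apply: bmeasM => //; exact: bmeas_cst.
rewrite wintZ// wint_cst => h2.
have h3 : s * wint (fun=> 1) <= s / s `^ p * wint (fun x => `|g x| `^ p) by lra.
have sp0 : 0 < s `^ p by rewrite powR_gt0.
rewrite -(ler_pM2l (divr_gt0 s0 sp0)) mulrA divfK ?gt_eqF//.
Qed.

End weighted_integral.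

(** * A Lipschitz estimate for real powers *)

Section powR_lipschitz.
Context {R : realType}.

(** A mean value inequality with an integer k > p in place of the factor p: for u = s / t, u^p >=
    u^k >= 1 - k (1 - u) by Bernoulli's inequality. *)
Lemma powR_sub_le (p s t : R) : 1 <= p -> 0 <= s <= t ->
  t `^ p - s `^ p <= (Num.truncn p).+1%:R * t `^ (p - 1) * (t - s).
Proof.
move=> p1 /andP[s0 st]; have [t0|t0] := leP t 0.
  have -> : s = t by lra.
  by rewrite !subrr mulr0.
have p0 : 0 < p by lra.
pose u := s / t; have u01 : 0 <= u <= 1.
  by rewrite divr_ge0 ?(ltW t0)//= ler_pdivrMr// mul1r.
have [u0 u1] := andP u01.
have sE : s = t * u by rewrite mulrC divfK// gt_eqF.
have up : 1 - (Num.truncn p).+1%:R * (1 - u) <= u `^ p.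
  have [u00|u00] := eqVneq u 0.
    by rewrite u00 subr0 mulr1 powR0 ?gt_eqF// subr_le0 ler1n.
  apply: (le_trans (@bernoulli_ge R (1 - u) (Num.truncn p).+1 _)).
    by apply/andP; split; lra.
  rewrite opprB addrC subrK -powR_mulrn// ger_powR//.
    by rewrite lt_neqAle eq_sym u00 u0.
  by rewrite ltW// truncnS_gt.
rewrite {1 2}sE (powRM _ (ltW t0) u0).
have -> : t - t * u = t * (1 - u) by ring.
rewrite -[leLHS]/(t `^ p - t `^ p * u `^ p).
have -> : (Num.truncn p).+1%:R * t `^ (p - 1) * (t * (1 - u)) =
    t `^ p * ((Num.truncn p).+1%:R * (1 - u)).
  by rewrite -(mulr_powRB1 (ltW t0) p0); ring.
rewrite -[X in X - _]mulr1 -mulrBr ler_wpM2l ?powR_ge0//.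
lra.
Qed.

Lemma powR_lipschitz (p L s t : R) : 1 <= p -> 0 <= s <= L -> 0 <= t <= L ->
  `|t `^ p - s `^ p| <= (Num.truncn p).+1%:R * L `^ (p - 1) * `|t - s|.
Proof.
move=> p1; wlog st : s t / s <= t => [H|].
  have [/H//|/ltW ts] := leP s t.
  by move=> s0 t0; rewrite distrC [`|t - s|]distrC; exact: H.
move=> /andP[s0 sL] /andP[t0 tL].
rewrite !ger0_norm ?subr_ge0//; last by rewrite ge0_ler_powR ?nnegrE//; lra.
apply: le_trans (powR_sub_le p1 _) _; first by rewrite s0.
rewrite ler_wpM2r ?subr_ge0// ler_wpM2l// ge0_ler_powR ?nnegrE//; lra.
Qed.

End powR_lipschitz.

(** * Scalar product, unit sphere and bounds on compact sets *)

Section euclidean.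
Context {R : realType} {n : nat}.
Implicit Types x y xi : 'rV[R]_n.

Lemma dotvZr x (c : R) y : dotv x (c *: y) = c * dotv x y.
Proof.
rewrite /dotv mulr_sumr; apply: eq_bigr => i _.
by rewrite mxE mulrCA.
Qed.

Lemma dotvZl x (c : R) y : dotv (c *: x) y = c * dotv x y.
Proof.
rewrite /dotv mulr_sumr; apply: eq_bigr => i _.
by rewrite mxE mulrA.
Qed.

Lemma dotvDl x y xi : dotv (x + y) xi = dotv x xi + dotv y xi.
Proof.
by rewrite /dotv -big_split; apply: eq_bigr => i _; rewrite mxE mulrDl.
Qed.

Lemma dotvBr x y xi : dotv x (y - xi) = dotv x y - dotv x xi.
Proof.
by rewrite /dotv -sumrB; apply: eq_bigr => i _; rewrite !mxE mulrBr.
Qed.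

Lemma dotv_ge0 x : 0 <= dotv x x.
Proof. by apply: sumr_ge0 => i _; rewrite -expr2 sqr_ge0. Qed.

Lemma dotv_norm_le x y (r : R) : (forall i, `|x 0 i| <= r) ->
  `|dotv x y| <= r * \sum_i `|y 0 i|.
Proof.
move=> xr; apply: le_trans (ler_norm_sum _ _ _) _; rewrite mulr_sumr.
by apply: ler_sum => i _; rewrite normrM ler_wpM2r.
Qed.

Lemma sphereP xi : sphere xi <-> dotv xi xi = 1.
Proof.
rewrite /sphere /enorm /=; split => [h|->]; last exact: sqrtr1.
by rewrite -[LHS]sqr_sqrtr ?dotv_ge0// h expr1n.
Qed.

Lemma sphere_normalize xi : 0 < dotv xi xi ->
  sphere ((Num.sqrt (dotv xi xi))^-1 *: xi).
Proof.
move=> h; apply/sphereP; rewrite dotvZr dotvZl mulrA -expr2 exprVn sqr_sqrtr ?ltW//.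
by rewrite mulVf// gt_eqF.
Qed.

Lemma sphere_nonempty : (0 < n)%N -> @sphere R n !=set0.
Proof.
move=> n0; pose i0 := Ordinal n0; exists (delta_mx 0 i0); apply/sphereP.
rewrite /dotv (bigD1 i0)//= !mxE !eqxx /= mulr1 big1 ?addr0// => i /negbTE ii0.
by rewrite !mxE ii0 andbF mulr0.
Qed.

Lemma sphere_entry_le1 xi i : sphere xi -> `|xi 0 i| <= 1.
Proof.
move=> /sphereP xi1; rewrite -(@ler_pXn2r _ 2) ?nnegrE// expr1n real_normK ?num_real//.
rewrite -xi1 /dotv (bigD1 i)//= -expr2 lerDl.
by apply: sumr_ge0 => j _; rewrite -expr2 sqr_ge0.
Qed.

Lemma continuous_sum (T : topologicalType) (I : Type) (s : seq I) (F : I -> T -> R) :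
  (forall i, continuous (F i)) -> continuous (fun t : T => \sum_(i <- s) F i t).
Proof.
move=> cF; elim: s => [|i s IHs].
  by under eq_fun do rewrite big_nil; exact: cst_continuous.
under eq_fun do rewrite big_cons.
by move=> t; apply: cvgD; [exact: cF|exact: IHs].
Qed.

Lemma continuous_dotvr y : continuous (fun x : 'rV[R]_n => dotv x y).
Proof.
apply: continuous_sum => i x.
exact: (cvgM (@coord_continuous R 1 n 0 i x) (cvg_cst _)).
Qed.

Lemma compact_sphere : compact (@sphere R n).
Proof.
apply: bounded_closed_compact.
  exists 1; split => // M M1 x xs; rewrite /Num.norm /= mx_normrE.
  apply/bigmax_leP; split; first lra.
  by move=> [i j] _ /=; rewrite ord1; apply: le_trans (sphere_entry_le1 _ xs) (ltW M1).
rewrite (_ : sphere = (fun x : 'rV[R]_n => dotv x x) @^-1` [set 1]).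
  apply: preimage_closed; last exact: closed_eq.
  move=> x _; apply: continuous_sum => i y.
  by have h := @coord_continuous R 1 n 0 i y; exact: (cvgM h h).
by apply/seteqP; split => x /sphereP.
Qed.

Lemma compact_entry_bound (K : set 'rV[R]_n) : compact K ->
  exists2 r : R, 0 <= r & forall x, K x -> forall i, `|x 0 i| <= r.
Proof.
move=> /compact_bounded[M [Mr MK]]; exists (`|M| + 1); first by rewrite addr_ge0.
move=> x Kx i; have : `|x| <= `|M| + 1.
  by apply: MK => //; apply: le_lt_trans (ler_norm M) _; rewrite ltrDl.
apply: le_trans; rewrite [leRHS]/Num.norm /= mx_normrE.
exact: (le_bigmax _ (fun ij => `|x ij.1 ij.2|) (0, i)).
Qed.

Lemma compact_volume_lty (K : set 'rV[R]_n) : compact K -> (vol K < +oo)%E.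
Proof.
move=> kK; have [r r0 Kr] := compact_entry_bound kK.
apply: (@le_lt_trans _ _ (lebesgue_rV R n
    [set x : 'rV[R]_n | forall i, `|x 0 i - (0 : 'rV[R]_n) 0 i| <= r])).
  apply: le_measure.
  - by apply/mem_set; exact: compact_measurable_rV.
  - by apply/mem_set; exact: (measurable_cube 0).
  - by move=> x Kx i; rewrite mxE subr0; exact: Kr.
by rewrite lebesgue_cube// ltry.
Qed.

End euclidean.

(** * Moments as functions of the direction *)

Section moments.
Context {R : realType} {n : nat}.
Variables (K : set 'rV[R]_n) (f : 'rV[R]_n -> R).
Hypotheses (kK : compact K) (cf : {within K, continuous f})
  (f0 : forall x, K x -> 0 <= f x).
Local Notation mu := (lebesgue_rV R n).

Lemma body_bmeas : bmeas K f.
Proof.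
split; first exact: within_continuous_measurable_rV (compact_measurable_rV kK) cf.
have [M [Mr MK]] := compact_bounded (continuous_compact cf kK).
exists (`|M| + 1) => x Kx; apply: MK; last by exists x.
by apply: le_lt_trans (ler_norm M) _; rewrite ltrDl.
Qed.

Lemma bmeas_dotv xi : bmeas K (fun x => dotv x xi).
Proof.
split.
  apply: within_continuous_measurable_rV; first exact: compact_measurable_rV.
  by apply: continuous_subspaceT; exact: continuous_dotvr.
have [r r0 Kr] := compact_entry_bound kK.
by exists (r * \sum_i `|xi 0 i|) => x Kx; apply: dotv_norm_le; exact: Kr.
Qed.

Definition rmoment p xi : R := wint mu K f (fun x => `|dotv x xi| `^ p).

Lemma momentE p xi : 0 <= p -> moment K f p xi = (rmoment p xi)%:E.
Proof.
move=> p0; rewrite /rmoment -wintE//.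
- exact: compact_measurable_rV.
- exact: compact_volume_lty.
- exact: body_bmeas.
- by apply: bmeas_powR => //; exact: bmeas_dotv.
Qed.

(** On the sup-norm unit ball about xi all |(x, z)| with x in K are at most [L], so the p-th power
    is Lipschitz there; [C] collects its constant, the factor r n from |(x, xi - eta)| <= r n e, and
    the mass of f. Continuity is what makes the minimum over the sphere exist. *)
Lemma continuous_rmoment p : 1 <= p -> continuous (rmoment p).
Proof.
move=> p1 xi; have mK := compact_measurable_rV kK.
have vK := compact_volume_lty kK; have bf := body_bmeas.
have [r r0 Kr] := compact_entry_bound kK.
have p0 : 0 <= p by lra.
pose L := r * \sum_(i < n) (`|xi 0 i| + 1).
pose J := wint mu K f (fun=> 1).
have J0 : 0 <= J by apply: wint_ge0.
have L0 : 0 <= L by rewrite mulr_ge0// sumr_ge0// => i _; rewrite addr_ge0.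
pose C := (Num.truncn p).+1%:R * L `^ (p - 1) * (r * n%:R) * J.
have C0 : 0 <= C by rewrite !mulr_ge0 ?powR_ge0.
have lip (eta : 'rV[R]_n) (e : R) : e <= 1 -> (forall i, `|xi 0 i - eta 0 i| < e) ->
    `|rmoment p xi - rmoment p eta| <= C * e.
  move=> e1 xe.
  have dL (z : 'rV[R]_n) x : (forall i, `|z 0 i| <= `|xi 0 i| + 1) -> K x ->
      0 <= `|dotv x z| <= L.
    move=> zb Kx; rewrite normr_ge0 /=; apply: le_trans (dotv_norm_le _ (Kr x Kx)) _.
    by rewrite ler_wpM2l// ler_sum.
  have etab i : `|eta 0 i| <= `|xi 0 i| + 1.
    have -> : eta 0 i = xi 0 i - (xi 0 i - eta 0 i) by lra.
    apply: le_trans (ler_normB _ _) _; rewrite lerD2l.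
    by apply: le_trans e1; exact/ltW/xe.
  have xib i : `|xi 0 i| <= `|xi 0 i| + 1 by rewrite lerDl.
  have bx z : bmeas K (fun x => `|dotv x z| `^ p).
    by apply: bmeas_powR => //; exact: bmeas_dotv.
  have pt x : K x -> `| `|dotv x xi| `^ p - `|dotv x eta| `^ p| <=
      (Num.truncn p).+1%:R * L `^ (p - 1) * (r * n%:R) * e.
    move=> Kx; apply: le_trans (powR_lipschitz p1 (dL eta x etab Kx) (dL xi x xib Kx)) _.
    rewrite -[leRHS]mulrA ler_wpM2l ?mulr_ge0 ?powR_ge0//.
    apply: le_trans (ler_dist_dist _ _) _; rewrite -dotvBr.
    apply: le_trans (dotv_norm_le _ (Kr x Kx)) _; rewrite -mulrA ler_wpM2l//.
    apply: (@le_trans _ _ (\sum_(i < n) e)).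
      by apply: ler_sum => i _; rewrite !mxE; exact/ltW/xe.
    by rewrite sumr_const card_ord mulr_natl.
  have half (z w : 'rV[R]_n) : (forall x, K x -> `|dotv x z| `^ p <=
      `|dotv x w| `^ p + (Num.truncn p).+1%:R * L `^ (p - 1) * (r * n%:R) * e) ->
      rmoment p z <= rmoment p w + C * e.
    move=> zw; have -> : C * e = wint mu K f
        (fun=> (Num.truncn p).+1%:R * L `^ (p - 1) * (r * n%:R) * e).
      by rewrite wint_cst// -/J /C mulrAC.
    rewrite -wintD//; last exact: bmeas_cst.
    by apply: le_wint => //; apply: bmeasD => //; exact: bmeas_cst.
  rewrite ler_distl; apply/andP; split.
    rewrite lerBlDr; apply: half => x Kx.
    by have := pt x Kx; rewrite ler_distl => /andP[]; lra.
  apply: half => x Kx.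
  by have := pt x Kx; rewrite ler_distl => /andP[]; lra.
apply/(@cvgrPdist_lt _ _ _ (nbhs xi)) => eps eps0; apply/nbhs_rVP.
(* The bound 1 keeps [eta] in the ball of the Lipschitz estimate; [C] may vanish, hence [C + 1]. *)
pose e := Num.min 1 (eps / (2 * (C + 1))).
have C1 : 0 < 2 * (C + 1) by lra.
exists e; first by rewrite lt_min ltr01 divr_gt0.
move=> eta xe; apply: (@le_lt_trans _ _ (C * e)).
  by apply: lip xe; rewrite ge_min lexx.
apply: (@le_lt_trans _ _ ((C + 1) * (eps / (2 * (C + 1))))).
  have e_ge0 : 0 <= e by rewrite le_min ler01 divr_ge0// ltW.
  have e_le : e <= eps / (2 * (C + 1)) by rewrite ge_min lexx orbT.
  by apply: ler_pM => //; rewrite lerDl.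
have -> : (C + 1) * (eps / (2 * (C + 1))) = eps / 2.
  by field; rewrite gt_eqF//; lra.
lra.
Qed.

Lemma least_moment p : (0 < n)%N -> 1 <= p ->
  exists2 xi, sphere xi & is_least (moment K f p @` sphere) (moment K f p xi).
Proof.
move=> n0 p1; have p0 : 0 <= p by lra.
have [xi /set_mem xis xiP] := EVT_min_rV (sphere_nonempty n0) compact_sphere
  (continuous_subspaceT (continuous_rmoment p1)).
exists xi => //; split; first by exists xi.
move=> _ [eta etas <-]; rewrite (momentE xi p0) (momentE eta p0) lee_fin; apply: xiP.
exact: mem_set.
Qed.

End moments.

(** * The upper bound *)

Section upper_bound.
Context {R : realType}.

Lemma pow_le_fact (n : nat) : n%:R ^+ n <= expR 1 ^+ n * n`!%:R :> R.
Proof.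
elim: n => [|n IHn]; first by rewrite !expr0 mul1r fact0.
have e0 : 0 <= expR 1 :> R := expR_ge0 _.
have [->|n0] := posnP n.
  rewrite !expr1 (_ : 1`! = 1%N)// mulr1.
  by apply: le_trans (expR_ge1Dx 1); rewrite lerDl.
have nR0 : 0 < n%:R :> R by rewrite ltr0n.
have h : n.+1%:R ^+ n <= expR 1 * n%:R ^+ n :> R.
  have -> : n.+1%:R = (1 + n%:R^-1) * n%:R :> R.
    by rewrite mulrDl mul1r mulVf ?gt_eqF// -natr1 addrC.
  rewrite exprMn ler_wpM2r ?exprn_ge0//.
  have -> : expR 1 = expR n%:R^-1 ^+ n :> R.
    by rewrite -expRM_natl mulr_natl -mulr_natr mulVf ?gt_eqF.
  by rewrite lerXn2r ?nnegrE ?expR_ge0 ?expR_ge1Dx// addr_ge0.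
rewrite exprS factS natrM mulrCA ler_wpM2l// exprS -mulrA.
apply: le_trans h _; rewrite ler_wpM2l//.
Qed.

(** If every i with h i > H / 2 failed, all terms m i - B (h i - H / 2) would be nonnegative with
    sum at most 0. They would vanish, so no h i could exceed H / 2, against the mean H. Here m is
    the moment and h the squared length of a random direction. *)
Lemma averaging (I : finType) (m h : I -> R) (H B : R) :
  (0 < #|I|)%N -> (forall i, 0 <= m i) -> 0 < H -> 0 <= B ->
  \sum_i m i <= #|I|%:R * (B * (H / 2)) -> \sum_i h i = #|I|%:R * H ->
  exists2 i, H / 2 < h i & m i <= B * (h i - H / 2).
Proof.
move=> I0 m0 H0 B0 sm sh; apply: contrapT => none.
have I0' : 0 < #|I|%:R :> R by rewrite ltr0n.
have all_gt i : H / 2 < h i -> B * (h i - H / 2) < m i.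
  by move=> hi; rewrite ltNge; apply/negP => mi; apply: none; exists i.
have term_ge0 i : 0 <= m i - B * (h i - H / 2).
  have [hi|hi] := ltP (H / 2) (h i); first by rewrite subr_ge0 ltW// all_gt.
  have : B * (h i - H / 2) <= 0 by rewrite mulr_ge0_le0// subr_le0.
  by have := m0 i; lra.
have sum_eq : \sum_i (m i - B * (h i - H / 2)) =
    \sum_i m i - #|I|%:R * (B * (H / 2)).
  rewrite sumrB -mulr_sumr sumrB sh sumr_const -[_ *+ #|_|]mulr_natl.
  rewrite (_ : #|xpredT| = #|I|)//.
  by field.
have sum0 : \sum_i (m i - B * (h i - H / 2)) = 0.
  by apply/eqP; rewrite eq_le sum_eq subr_le0 sm -sum_eq sumr_ge0.
have h_le i : h i <= H / 2.
  rewrite leNgt; apply/negP => hi; have := all_gt i hi.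
  have /eqP := sum0; rewrite psumr_eq0// => /allP/(_ i (mem_index_enum i)) /=.
  by rewrite subr_eq0 => /eqP ->; rewrite ltxx.
have : \sum_i h i <= \sum_(i : I) H / 2 by apply: ler_sum => i _.
rewrite sh sumr_const -[_ *+ #|_|]mulr_natl ler_pM2l//; lra.
Qed.

(** Khintchine's inequality with variance 3 n contributes e^2 sqrt (3 p n), normalisation
    contributes sqrt (2 / H) <= sqrt (2 e) |K|^(1/n), and the leading 2 absorbs the factor 2 <= 2^p
    of Khintchine's inequality. *)
Definition upper_cst : R := 2 * expR 2 * Num.sqrt (6 * expR 1).

Lemma upper_cst_gt0 : 0 < upper_cst.
Proof. by rewrite !mulr_gt0 ?expR_gt0 ?sqrtr_gt0 ?mulr_gt0 ?expR_gt0. Qed.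

Section body.
Variables (n : nat) (K : set 'rV[R]_n) (f : 'rV[R]_n -> R).
Hypotheses (n0 : (0 < n)%N) (bK : convex_body K) (sK : centrally_symmetric K)
  (cf : {within K, continuous f}) (f0 : forall x, K x -> 0 <= f x).

Let kK : compact K. Proof. by case: bK. Qed.
Let cK : convex_set K. Proof. by case: bK. Qed.
Let K0 : K 0.
Proof.
by apply: symmetric_convex0 => //; case: bK => _ _ [x /interior_subset]; exists x.
Qed.

Lemma body_volumeE : vol K = (fine (vol K))%:E.
Proof.
by rewrite fineK// ge0_fin_numE; [exact: compact_volume_lty|exact: measure_ge0].
Qed.

Lemma body_volume_gt0 : 0 < fine (vol K).
Proof.
have [x [xK dx]] := convex_body_full bK sK.
have := det_le_volume n0 kK cK K0 xK; rewrite body_volumeE lee_fin => h.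
rewrite ltNge; apply/negP => V0.
have : n%:R ^+ n * fine (vol K) <= 0 by rewrite mulr_ge0_le0 ?exprn_ge0.
by move=> /(le_trans h); rewrite normr_le0 (negbTE dx).
Qed.

Let v := fine (vol K) `^ n%:R^-1.

Let v0 : 0 < v. Proof. by rewrite powR_gt0// body_volume_gt0. Qed.

Let vn : v ^+ n = fine (vol K).
Proof.
rewrite -powR_mulrn ?ltW// -powRrM mulVf ?pnatr_eq0 -?lt0n// powRr1//.
exact/ltW/body_volume_gt0.
Qed.

Let J := wint (lebesgue_rV R n) K f (fun=> 1).

Let mK := compact_measurable_rV kK.
Let vK := compact_volume_lty kK.
Let bf := body_bmeas kK cf.

Let J0 : 0 <= J. Proof. exact: wint_ge0. Qed.

(** As n! >= (n / e)^n, the left side of the second hypothesis is at least (e n v^2)^(-n); taking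
    n-th roots gives H >= 1 / (e v^2). *)
Let H_ge (H : R) : 0 <= H ->
  n`!%:R / (n%:R ^+ n * fine (vol K)) ^+ 2 <= (H / n%:R) ^+ n ->
  H^-1 <= expR 1 * v ^+ 2 /\ 0 < H.
Proof.
move=> H0 le_H.
have nR0 : 0 < n%:R :> R by rewrite ltr0n.
have V0 := body_volume_gt0.
have e0 : 0 < expR 1 :> R := expR_gt0 1.
pose q := (expR 1 * n%:R * v ^+ 2)^-1.
have q0 : 0 < q by rewrite invr_gt0 !mulr_gt0// exprn_gt0.
have qH : q <= H / n%:R.
  rewrite -(@ler_pXn2r _ n) ?nnegrE ?divr_ge0 ?(ltW q0)//.
  apply: le_trans le_H.
  rewrite ler_pdivlMr ?exprn_gt0 ?mulr_gt0 ?exprn_gt0//.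
  have -> : q ^+ n * (n%:R ^+ n * fine (vol K)) ^+ 2 = n%:R ^+ n / expR 1 ^+ n.
    rewrite -vn /q exprVn !exprMn; field.
    by rewrite !expf_neq0// gt_eqF.
  by rewrite ler_pdivrMr ?exprn_gt0// mulrC pow_le_fact.
have H_gt0 : 0 < H.
  by have := lt_le_trans q0 qH; rewrite pmulr_lgt0 ?invr_gt0.
split=> //; rewrite -[leRHS]invrK lef_pV2 ?posrE ?invr_gt0 ?mulr_gt0 ?exprn_gt0//.
have -> : (expR 1 * v ^+ 2)^-1 = q * n%:R.
  by rewrite /q; field; rewrite !gt_eqF.
by rewrite -ler_pdivlMr.
Qed.

(* The random direction xi e = sum_i e_i Z_i has <x, xi e> subgaussian with variance at most
   3 n on K, while |xi e|^2 averages to H >= 1 / (e v^2). *)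
Let upper_ge2 p : 2 <= p -> exists2 xi, sphere xi &
  rmoment K f p xi <= (upper_cst * Num.sqrt (p * n%:R) * v) `^ p * J.
Proof.
move=> p2; have p0 : 0 < p by lra.
have nR0 : 0 < n%:R :> R by rewrite ltr0n.
have det_le (x : 'I_n -> 'rV[R]_n) : (forall j, K (x j)) ->
    `|\det (\matrix_j x j)| <= n%:R ^+ n * fine (vol K).
  by move=> xK; have := det_le_volume n0 kK cK K0 xK; rewrite body_volumeE lee_fin.
have [N [Z [ZK HZ]]] := loewner_position det_le n0 (convex_body_full bK sK).
set H := \sum_i _ in HZ.
have H0 : 0 <= H.
  by apply: sumr_ge0 => i _; apply: sumr_ge0 => j _; exact: sqr_ge0.
have [H_inv H_gt0] := H_ge H0 HZ.
pose xi (e : {ffun 'I_N -> bool}) : 'rV[R]_n := \row_j rsum (fun i => Z i j) e.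
have dot_xi x e : dotv x (xi e) = rsum (fun i => (Z *m x^T) i 0) e.
  rewrite /dotv /rsum; under eq_bigr do rewrite mxE mulr_sumr.
  rewrite exchange_big /=; apply: eq_bigr => i _.
  rewrite mxE mulr_sumr; apply: eq_bigr => j _.
  by rewrite mxE; ring.
pose A : R := 2 * (expR 2 * Num.sqrt (p * (3 * n%:R))) `^ p.
have A0 : 0 <= A by rewrite mulr_ge0 ?powR_ge0.
have bx e : bmeas K (fun x => `|dotv x (xi e)| `^ p).
  by apply: bmeas_powR; [exact: ltW|exact: bmeas_dotv].
(* The bound A J is written as B * (H / 2) with B = A J / (H / 2), the form that [averaging]
   takes. *)
have sum_m : \sum_e rmoment K f p (xi e) <=
    #|{ffun 'I_N -> bool}|%:R * ((A * J / (H / 2)) * (H / 2)).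
  rewrite divfK ?gt_eqF ?divr_gt0// /rmoment -wint_sum// card_signs mulrA.
  rewrite -[leRHS]wint_cst//.
  apply: le_wint => //; [exact: bmeas_sum|exact: bmeas_cst|].
  move=> x Kx; under eq_bigr do rewrite dot_xi.
  by apply: rsum_khintchine => //; [rewrite mulr_gt0|exact: ZK].
have sum_h : \sum_e dotv (xi e) (xi e) = #|{ffun 'I_N -> bool}|%:R * H.
  have -> : H = \sum_j \sum_i Z i j ^+ 2 by rewrite /H exchange_big.
  have -> : \sum_e dotv (xi e) (xi e) = \sum_j \sum_e xi e 0 j * xi e 0 j.
    by rewrite exchange_big.
  rewrite card_signs mulr_sumr; apply: eq_bigr => j _; rewrite -rsum_moment2; apply: eq_bigr => e _.
  by rewrite !mxE expr2.
have [|||e he me] := averaging _ _ H_gt0 _ sum_m sum_h.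
- by rewrite card_ffun card_bool expn_gt0.
- by move=> e; apply: wint_ge0 => // x Kx; exact: powR_ge0.
- by rewrite divr_ge0 ?mulr_ge0// divr_ge0.
set h := dotv _ _ in he me; set g := H / 2 in he me.
have g0 : 0 < g by rewrite divr_gt0.
have h0 : 0 < h := lt_trans g0 he.
have sh0 : 0 < Num.sqrt h by rewrite sqrtr_gt0.
have sg0 : 0 < Num.sqrt g by rewrite sqrtr_gt0.
exists ((Num.sqrt h)^-1 *: xi e); first exact: sphere_normalize.
have -> : rmoment K f p ((Num.sqrt h)^-1 *: xi e) =
    (Num.sqrt h)^-1 `^ p * rmoment K f p (xi e).
  rewrite /rmoment -wintZ//; apply: eq_Rintegral => x _; congr (_ * _).
  by rewrite dotvZr normrM powRM// ger0_norm ?invr_ge0 ?sqrtr_ge0.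
(* Normalising costs h^(-p/2). Since h > g and p >= 2, (h - g) / g <= h / g <= (h / g)^(p/2), so an
   unusually long or short direction does no harm. *)
have key : (Num.sqrt h)^-1 `^ p * (h - g) <= g * (Num.sqrt g)^-1 `^ p.
  have le1 : h - g <= g * (Num.sqrt h / Num.sqrt g) `^ p.
    apply: (@le_trans _ _ (g * (Num.sqrt h / Num.sqrt g) `^ 2)).
      rewrite powR_mulrn ?divr_ge0 ?sqrtr_ge0// expr_div_n !sqr_sqrtr ?ltW//.
      rewrite mulrCA divff ?gt_eqF// mulr1; lra.
    by rewrite ler_wpM2l ?(ltW g0)// ler_powR// ler_pdivlMr// mul1r ler_sqrt ?(ltW h0)// ltW.
  apply: le_trans (ler_wpM2l (powR_ge0 _ _) le1) _.
  rewrite mulrCA -powRM ?invr_ge0 ?divr_ge0 ?sqrtr_ge0//.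
  by rewrite mulrA mulVf ?mul1r// gt_eqF.
apply: (@le_trans _ _ (A * J * (Num.sqrt g)^-1 `^ p)).
  apply: le_trans (ler_wpM2l (powR_ge0 _ _) me) _.
  rewrite mulrCA; apply: le_trans (ler_wpM2l _ key) _.
    by rewrite divr_ge0 ?mulr_ge0// ltW.
  by rewrite mulrA divfK// gt_eqF.
have a0 : 0 <= expR 2 * Num.sqrt (p * (3 * n%:R)) :> R.
  by rewrite mulr_ge0 ?expR_ge0 ?sqrtr_ge0.
have b0 : 0 <= (Num.sqrt g)^-1 by rewrite invr_ge0 ltW.
rewrite mulrAC ler_wpM2r// /A -[leLHS]mulrA -(powRM _ a0 b0).
have uE : upper_cst / 2 = expR 2 * Num.sqrt (6 * expR 1).
  by rewrite /upper_cst; field.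
have c0 : 0 <= upper_cst / 2 * Num.sqrt (p * n%:R) * v.
  rewrite uE; apply: mulr_ge0; last exact: ltW.
  by rewrite !mulr_ge0 ?expR_ge0 ?sqrtr_ge0.
apply: (@le_trans _ _ (2 `^ p * (upper_cst / 2 * Num.sqrt (p * n%:R) * v) `^ p)).
  apply: ler_pM; [by []|exact: powR_ge0| |].
    by rewrite -[leLHS]powRr1// ler_powR ?ler1n//; lra.
  rewrite ge0_ler_powR ?nnegrE ?(ltW p0) ?(mulr_ge0 a0 b0)//.
  rewrite uE -!mulrA ler_pM2l ?expR_gt0// -sqrtrV ?(ltW g0)//.
  have -> : v = Num.sqrt (v ^+ 2) by rewrite sqrtr_sqr gtr0_norm.
  have pn_ge0 : 0 <= p * n%:R by rewrite mulr_ge0 ?(ltW p0).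
  have p3n_ge0 : 0 <= p * (3 * n%:R) by rewrite mulr_ge0 ?(ltW p0)// mulr_ge0.
  have e6_ge0 : 0 <= 6 * expR 1 :> R by rewrite mulr_ge0 ?expR_ge0.
  rewrite -(sqrtrM _ p3n_ge0) -(sqrtrM _ pn_ge0) -(sqrtrM _ e6_ge0).
  rewrite ler_sqrt; last by rewrite mulr_ge0// mulr_ge0// exprn_ge0// ltW.
  have -> : g^-1 = 2 * H^-1 by rewrite /g invf_div.
  have pn0 : 0 <= 6 * p * n%:R by rewrite !mulr_ge0 ?(ltW p0).
  by have := ler_wpM2l pn0 H_inv; lra.
have -> : upper_cst * Num.sqrt (p * n%:R) * v =
    2 * (upper_cst / 2 * Num.sqrt (p * n%:R) * v) by field.
by rewrite (powRM _ (ler0n R 2) c0).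
Qed.

(** For p < 2 the direction found for p = 2 serves: the comparison of moments costs a factor 2, and
    sqrt (2 n) <= 2 sqrt (p n) another 2. *)
Lemma moment_upper_bound p : 1 <= p -> exists2 xi, sphere xi &
  rmoment K f p xi <= (4 * upper_cst * Num.sqrt (p * n%:R) * v) `^ p * J.
Proof.
move=> p1; have p0 : 0 < p by lra.
have uv0 : 0 <= upper_cst * v by rewrite mulr_ge0// ltW// upper_cst_gt0.
have [p2|p2] := leP 2 p.
  have [xi xis xi_le] := upper_ge2 p2; exists xi => //.
  apply: le_trans xi_le _; rewrite ler_wpM2r//.
  have h0 : 0 <= upper_cst * Num.sqrt (p * n%:R) * v.
    by rewrite mulrAC mulr_ge0 ?sqrtr_ge0.
  by rewrite ge0_ler_powR ?nnegrE ?(ltW p0)//; lra.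
have [xi xis xi_le] := upper_ge2 (lexx 2); exists xi => //.
pose s := upper_cst * Num.sqrt (2 * n%:R) * v.
have s0 : 0 < s.
  rewrite !mulr_gt0 ?upper_cst_gt0 ?sqrtr_gt0 ?mulr_gt0 ?ltr0n//.
apply: (@le_trans _ _ ((2 * s) `^ p * J)).
  apply: wint_powR_le2 => //; first by rewrite p1 ltW.
    exact: bmeas_dotv.
  by rewrite -powR_mulrn ?(ltW s0).
rewrite ler_wpM2r//.
have h : Num.sqrt (2 * n%:R) <= 2 * Num.sqrt (p * n%:R).
  rewrite -[2 in X in _ <= X](@gtr0_norm R)// -sqrtr_sqr -sqrtrM ?exprn_ge0//.
  rewrite ler_sqrt ?mulr_ge0 ?exprn_ge0 ?(ltW p0)//.
  have : 0 <= (p - 1) * n%:R by rewrite mulr_ge0// subr_ge0.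
  have : 0 <= n%:R :> R by [].
  lra.
have le_s : 2 * s <= 4 * upper_cst * Num.sqrt (p * n%:R) * v.
  have := ler_wpM2l uv0 h; rewrite /s; lra.
have s2 : 0 <= 2 * s by rewrite mulr_ge0 ?(ltW s0).
by rewrite ge0_ler_powR ?nnegrE ?(ltW p0)// (le_trans s2 le_s).
Qed.

End body.

Lemma moment_bound_upper (n : nat) (p : R) : (0 < n)%N -> 1 <= p ->
  moment_bound p n (4 * upper_cst * Num.sqrt (p * n%:R)).
Proof.
move=> n0 p1 K f bK sK cf f0 _; have p0 : 0 <= p by lra.
have kK : compact K by case: bK.
have [xi xis xi_least] := least_moment kK cf f0 n0 p1.
exists (moment K f p xi) => //.
have [eta etas eta_le] := moment_upper_bound n0 bK sK cf f0 p1.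
case: xi_least => _ /(_ (moment K f p eta)) /(_ (ex_intro2 _ _ eta etas erefl)).
move=> /le_trans; apply; rewrite momentE//.
rewrite [X in (_ <= _ * X)%E](_ : _ =
    (wint (lebesgue_rV R n) K f (fun=> 1))%:E); last first.
  rewrite -wintE//.
  - by apply: eq_integral => x _; rewrite mul1r.
  - exact: compact_measurable_rV.
  - exact: compact_volume_lty.
  - exact: body_bmeas.
  - exact: bmeas_cst.
rewrite (body_volumeE bK) poweR_EFin -!EFinM lee_fin; apply: le_trans eta_le _.
rewrite powRM ?powR_ge0//; last first.
  by rewrite !mulr_ge0 ?sqrtr_ge0 ?(ltW upper_cst_gt0).
by rewrite -powRrM [n%:R^-1 * p]mulrC.
Qed.

End upper_bound.

(** * Rounding to integer vectors *)

Section rounding.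
Context {R : realType}.

(* Rounding y_j up with probability its fractional part gives an unbiased error whose second
   moment is at most (1/4) sum |v_j|^2; the choices are made greedily, one coordinate at a time. *)
Lemma vector_rounding n m (y : 'I_m -> R) (v : 'I_m -> 'rV[R]_n) :
  exists2 z : 'I_m -> int, (forall j, `|(z j)%:~R - y j| <= 1) &
    dotv (\sum_j ((z j)%:~R - y j) *: v j) (\sum_j ((z j)%:~R - y j) *: v j) <=
    4^-1 * \sum_j dotv (v j) (v j).
Proof.
elim: m y v => [|m IHm] y v.
  exists (fun=> 0) => [[]//|].
  by rewrite !big_ord0 mulr0 /dotv big1// => i _; rewrite mxE mulr0.
have [z' z'1 z'2] := IHm (y \o lift ord0) (v \o lift ord0).
set s := \sum_j _ *: _ in z'2.
set w := v ord0; pose q (e : R) := dotv (e *: w + s) (e *: w + s).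
have qE e : q e = dotv s s + 2 * e * dotv w s + e ^+ 2 * dotv w w.
  rewrite /q /dotv !mulr_sumr -!big_split /=; apply: eq_bigr => i _.
  by rewrite !mxE; ring.
pose t := y ord0 - (Num.floor (y ord0))%:~R.
have /andP[t0 t1] : 0 <= t < 1.
  by rewrite subr_ge0 floor_le ltrBlDl -intrD1 floorD1_gt.
have w0 : 0 <= dotv w w := dotv_ge0 w.
have le_q : (exists2 e : int, `|e%:~R - y ord0| <= 1 &
    q (e%:~R - y ord0) <= dotv s s + 4^-1 * dotv w w).
  have e0 : (Num.floor (y ord0))%:~R - y ord0 = - t by rewrite /t opprB.
  have e1 : (Num.floor (y ord0) + 1)%:~R - y ord0 = 1 - t.
    by rewrite intrD1 /t; move: (_%:~R : R) => r; ring.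
  (* The mean of [q] at - t and 1 - t with weights 1 - t and t is |s|^2 + t (1 - t) |w|^2, so
     rounding up succeeds whenever rounding down fails. *)
  have [h|h] := leP (q (- t)) (dotv s s + 4^-1 * dotv w w).
    exists (Num.floor (y ord0)); rewrite e0//.
    by rewrite normrN ger0_norm// ltW.
  exists (Num.floor (y ord0) + 1); rewrite e1; first by rewrite ger0_norm; lra.
  rewrite leNgt; apply/negP => h'.
  have h1 : 0 <= t * (q (1 - t) - (dotv s s + 4^-1 * dotv w w)).
    by rewrite mulr_ge0// subr_ge0 ltW.
  have h0 : 0 < (1 - t) * (q (- t) - (dotv s s + 4^-1 * dotv w w)).
    by rewrite mulr_gt0// subr_gt0.
  have h2 : 0 <= (t - 2^-1) ^+ 2 * dotv w w by rewrite mulr_ge0// sqr_ge0.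
  rewrite !qE in h1 h0; move: h0 h1 h2; rewrite !expr2; nra.
have [e e1 eq] := le_q.
exists (fun j => if unlift ord0 j is Some k then z' k else e).
  move=> j; case: (unliftP ord0 j) => [k|] ->; first exact: z'1.
  exact: e1.
rewrite !big_ord_recl unlift_none.
have -> : \sum_(i < m) ((if unlift ord0 (lift ord0 i) is Some k then z' k else e)%:~R -
    y (lift ord0 i)) *: v (lift ord0 i) = s.
  by apply: eq_bigr => i _; rewrite liftK.
apply: le_trans eq _; rewrite -/w mulrDr [leRHS]addrC lerD2r.
exact: z'2.
Qed.

End rounding.

(** * Counting integer vectors of bounded l^1 norm *)

Section integer_points.

(* Integer vectors with entries of absolute value at most B, as signs and absolute values; the
   zero entries carry a redundant sign, so the count below is an overestimate. *)
Definition cell (m B : nat) := {ffun 'I_m -> 'I_B.+1 * bool}.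

Definition cell_size m B (c : cell m B) : nat := (\sum_j (c j).1)%N.

Definition cell_val (R : pzRingType) m B (c : cell m B) (j : 'I_m) : R :=
  (-1) ^+ (c j).2 * (c j).1%:R.

Lemma cell_cover (R : pzRingType) m B (z : 'I_m -> int) :
  (\sum_j `|z j|%N <= B)%N -> exists2 c : cell m B, (cell_size c <= B)%N &
    forall j, cell_val R c j = (z j)%:~R.
Proof.
move=> zB.
have zjB j : (`|z j|%N < B.+1)%N.
  by rewrite ltnS; apply: leq_trans zB; rewrite (bigD1 j)//= leq_addr.
exists [ffun j => (inord `|z j|%N, z j < 0)].
  rewrite /cell_size; under eq_bigr do rewrite ffunE /= inordK//.
  by [].
move=> j; rewrite /cell_val ffunE /= inordK//.
rewrite [in RHS](intEsign (z j)) rmorphM /= rmorph_sign.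
by congr (_ * _); rewrite -pmulrn.
Qed.

Lemma sum_half_pow (R : realFieldType) (B : nat) :
  \sum_(k < B) 2^-1 ^+ k <= 2 :> R.
Proof.
suff -> : \sum_(k < B) 2^-1 ^+ k = 2 - 2 * 2^-1 ^+ B :> R.
  by rewrite lerBlDr lerDl mulr_ge0// exprn_ge0// invr_ge0.
elim: B => [|B IHB]; first by rewrite big_ord0 expr0 mulr1 subrr.
by rewrite big_ord_recr /= IHB exprS; field.
Qed.

(** Every cell counted has weight 2^B 2^(- size) >= 1. The total weight of all cells factorises into
    m sums over an absolute value and a sign, each at most 2 * 2 = 4. *)
Lemma card_cells (R : realFieldType) m B :
  #|[pred c : cell m B | (cell_size c <= B)%N]|%:R <= 2 ^+ B * 4 ^+ m :> R.
Proof.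
have half0 k : 0 < 2^-1 ^+ k :> R by rewrite exprn_gt0// invr_gt0.
rewrite -sum1_card natr_sum.
apply: (@le_trans _ _ (\sum_(c : cell m B) 2 ^+ B * \prod_j (2^-1 : R) ^+ (c j).1)).
  rewrite [leRHS](bigID (fun c : cell m B => (cell_size c <= B)%N)) /=.
  rewrite -[leLHS]addr0; apply: lerD; last first.
    by apply: sumr_ge0 => c _; rewrite mulr_ge0 ?exprn_ge0 ?prodr_ge0// => j _; exact: ltW.
  apply: ler_sum => c; rewrite inE => cB.
  rewrite -(big_morph _ (exprD 2^-1) (expr0 _)) -/(cell_size c).
  rewrite exprVn ler_pdivlMr ?exprn_gt0// mul1r ler_eXn2l//.
  by rewrite ltr1n.
rewrite -mulr_sumr ler_wpM2l ?exprn_ge0//.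
rewrite -(bigA_distr_bigA (fun (j : 'I_m) (kb : 'I_B.+1 * bool) => (2^-1 : R) ^+ kb.1)) /=.
rewrite prodr_const card_ord lerXn2r ?nnegrE ?sumr_ge0//.
rewrite -(pair_big xpredT xpredT (fun (k : 'I_B.+1) (b : bool) => (2^-1 : R) ^+ k)) /=.
under eq_bigr do rewrite big_bool.
rewrite big_split /=; have := sum_half_pow R B.+1; lra.
Qed.

End integer_points.

(** * Random sign matrices *)

Section sign_matrices.
Context {R : realType}.

(** Only even powers occur on the right, so the second and fourth moments suffice: for a Rademacher
    sum with moments 1 and at most 3 the mean is at most 1 - 1/4 + 3/24 = 7/8. *)
Lemma expRN_le (u : R) : 0 <= u ->
  expR (- u) <= 1 - 4^-1 * u ^+ 2 + 24^-1 * u ^+ 4.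
Proof.
move=> u0; apply: (@le_trans _ _ (1 + u)^-1).
  by rewrite expRN lef_pV2 ?posrE ?expR_gt0 ?expR_ge1Dx//; lra.
have u1 : 0 < 1 + u by lra.
rewrite -[leLHS]mul1r ler_pdivrMr//.
rewrite -subr_ge0.
have -> : (1 - 4^-1 * u ^+ 2 + 24^-1 * u ^+ 4) * (1 + u) - 1 =
    u * (1 - 4^-1 * u * (1 + u) + 24^-1 * u ^+ 3 * (1 + u)) by field.
apply: mulr_ge0 => //.
have h1 : 0 <= (u ^+ 2 - 2) ^+ 2 by exact: sqr_ge0.
have h2 : 0 <= u * (u - 2) ^+ 2 by rewrite mulr_ge0 ?sqr_ge0.
have h3 : 0 <= (u - 2) ^+ 2 by exact: sqr_ge0.
move: h1 h2 h3; rewrite (_ : (u ^+ 2 - 2) ^+ 2 = u ^+ 4 - 4 * u ^+ 2 + 4); last by ring.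
rewrite (_ : u * (u - 2) ^+ 2 = u ^+ 3 - 4 * u ^+ 2 + 4 * u); last by ring.
rewrite (_ : (u - 2) ^+ 2 = u ^+ 2 - 4 * u + 4); last by ring.
rewrite (_ : 1 - 4^-1 * u * (1 + u) + 24^-1 * u ^+ 3 * (1 + u) =
  1 - 4^-1 * u - 4^-1 * u ^+ 2 + 24^-1 * u ^+ 3 + 24^-1 * u ^+ 4); last by field.
nra.
Qed.

Lemma rsumZ n (c : R) (a : 'I_n -> R) e : rsum (fun i => c * a i) e = c * rsum a e.
Proof. by rewrite /rsum mulr_sumr; apply: eq_bigr => i _; rewrite mulrCA. Qed.

Lemma rsum_expN_norm n (a : 'I_n -> R) : \sum_i a i ^+ 2 = 1 ->
  \sum_e expR (- `|rsum a e|) <= 2 ^+ n * (7 / 8).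
Proof.
move=> a1.
apply: (@le_trans _ _ (\sum_e (1 - 4^-1 * rsum a e ^+ 2 + 24^-1 * rsum a e ^+ 4))).
  apply: ler_sum => e _; have := expRN_le (normr_ge0 (rsum a e)).
  by rewrite (real_normK (num_real _)) -[X in _ * `|_| ^+ X]/(2 * 2)%N exprM
    (real_normK (num_real _)) -exprM.
rewrite !big_split /= sumrN -!mulr_sumr sum_signs_const rsum_moment2 a1.
have := rsum_moment4 a; rewrite a1; lra.
Qed.

(* Markov's inequality for the product over i of exp (1/16 - |<w, X i>| / |w|), and a union bound
   over the integer vectors w. *)
Lemma good_signs n (B N : nat) : 2 ^+ B * 4 ^+ n * (14 / 15) ^+ N < 1 :> R ->
  exists X : 'I_N -> {ffun 'I_n -> bool}, forall c : cell n B,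
    (cell_size c <= B)%N ->
    N%:R / 16 * Num.sqrt (\sum_j cell_val R c j ^+ 2) <=
      \sum_i `|rsum (cell_val R c) (X i)|.
Proof.
move=> small; apply: contrapT => none.
pose bad (c : cell n B) (X : {ffun 'I_N -> {ffun 'I_n -> bool}}) :=
  \sum_i `|rsum (cell_val R c) (X i)| <
    N%:R / 16 * Num.sqrt (\sum_j cell_val R c j ^+ 2).
have all_bad X : exists2 c, (cell_size c <= B)%N & bad c X.
  apply: contrapT => good; apply: none; exists X => c cB.
  by rewrite leNgt; apply/negP => cX; apply: good; exists c.
have card_bad c : (\sum_(X | bad c X) 1 : R) <= (2 ^+ n) ^+ N * (14 / 15) ^+ N.
  set w := cell_val R c; set s := Num.sqrt (\sum_j w j ^+ 2).
  have sum_ge0 : 0 <= \sum_j w j ^+ 2 by apply: sumr_ge0 => j _; exact: sqr_ge0.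
  have [s0|s0] := eqVneq s 0.
    rewrite big1 => [|X]; first by rewrite mulr_ge0 ?exprn_ge0 ?divr_ge0.
    rewrite /bad -/w -/s s0 mulr0 ltNge sumr_ge0// => i _; exact: normr_ge0.
  have s_gt0 : 0 < s by rewrite lt_neqAle eq_sym s0 sqrtr_ge0.
  pose a j := s^-1 * w j.
  have a1 : \sum_j a j ^+ 2 = 1.
    under eq_bigr do rewrite /a exprMn.
    by rewrite -mulr_sumr exprVn sqr_sqrtr// mulVf// -(sqr_sqrtr sum_ge0) expf_neq0.
  apply: (@le_trans _ _ (\sum_(X : {ffun 'I_N -> {ffun 'I_n -> bool}})
      \prod_i (expR 16^-1 * expR (- `|rsum a (X i)|)))).
    rewrite [leRHS](bigID (bad c)) /= -[leLHS]addr0; apply: lerD; last first.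
      by apply: sumr_ge0 => X _; apply: prodr_ge0 => i _; rewrite mulr_ge0 ?expR_ge0.
    apply: ler_sum => X bX.
    rewrite (eq_bigr (fun i => expR (16^-1 - `|rsum a (X i)|))); last first.
      by move=> i _; rewrite expRD.
    rewrite -expR_sum -[leLHS]expR0 ler_expR sumrB sumr_const card_ord subr_ge0.
    rewrite -[leRHS]mulr_natl; apply: ltW.
    have : s^-1 * \sum_i `|rsum w (X i)| < s^-1 * (N%:R / 16 * s).
      by rewrite ltr_pM2l ?invr_gt0.
    rewrite mulr_sumr [in ltRHS]mulrCA mulVf// mulr1; apply: le_lt_trans.
    apply: ler_sum => i _; rewrite /a rsumZ normrM ger0_norm//.
    by rewrite invr_ge0 ltW.
  rewrite -(bigA_distr_bigA (fun (_ : 'I_N) e => expR 16^-1 * expR (- `|rsum a e|))) /=.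
  rewrite prodr_const card_ord -exprMn lerXn2r ?nnegrE//.
    by apply: sumr_ge0 => e _; rewrite mulr_ge0 ?expR_ge0.
  rewrite -mulr_sumr.
  (* The failure rate per row is 16/15 * 7/8 = 14/15. *)
  have e16 : expR 16^-1 <= 16 / 15 :> R.
    rewrite -[16^-1]opprK expRN invf_ple ?posrE ?expR_gt0 ?divr_gt0//.
    by apply: le_trans (expR_ge1Dx _); lra.
  apply: (@le_trans _ _ (16 / 15 * (2 ^+ n * (7 / 8)))); last first.
    have : 0 <= 2 ^+ n :> R by exact: exprn_ge0.
    lra.
  apply: ler_pM => //; last exact: rsum_expN_norm.
  by apply: sumr_ge0 => e _; exact: expR_ge0.
have : (\sum_(X : {ffun 'I_N -> {ffun 'I_n -> bool}}) 1 : R) <=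
    \sum_(c : cell n B | (cell_size c <= B)%N) \sum_(X | bad c X) 1.
  under [leRHS]eq_bigr do rewrite big_mkcond /=.
  rewrite exchange_big /=; apply: ler_sum => X _.
  have [c cB cX] := all_bad X.
  rewrite (bigD1 c)//= cX lerDl; apply: sumr_ge0 => c' _.
  by case: ifP.
apply/negP; rewrite -ltNge.
apply: (@le_lt_trans _ _ (\sum_(c : cell n B | (cell_size c <= B)%N)
    ((2 ^+ n) ^+ N * (14 / 15) ^+ N))).
  by apply: ler_sum => c _; exact: card_bad.
have cardX : \sum_(X : {ffun 'I_N -> {ffun 'I_n -> bool}}) 1 = (2 ^+ n) ^+ N :> R.
  by rewrite sumr_const card_ffun card_ord natrX card_signs.
rewrite cardX sumr_const -[_ *+ _]mulr_natl.
have P0 : 0 < (2 ^+ n) ^+ N :> R by rewrite !exprn_gt0.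
rewrite mulrCA -[ltRHS]mulr1 ltr_pM2l//; apply: le_lt_trans small.
rewrite ler_wpM2r ?exprn_ge0 ?divr_ge0//.
exact: card_cells.
Qed.

(** The number of rows comes from 231 = 11 * 21: as (14/15)^11 <= 1/2, the failure probability is at
    most 2^(-21 n), against at most 2^(20 n) integer vectors. *)
Lemma good_signs_small n : (0 < n)%N ->
  2 ^+ (18 * n) * 4 ^+ n * (14 / 15) ^+ (231 * n) < 1 :> R.
Proof.
move=> n0.
have q2 : (14 / 15) ^+ 2 <= 7 / 8 :> R by rewrite expr2; lra.
have x0 : 0 <= 14 / 15 :> R by rewrite divr_ge0.
have q8 : ((14 / 15) ^+ 2) ^+ 4 <= 3 / 5 :> R.
  apply: (@le_trans _ _ ((7 / 8) ^+ 4)).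
    by rewrite lerXn2r ?nnegrE ?exprn_ge0// divr_ge0.
  by rewrite !exprS expr0; lra.
have q11 : (14 / 15) ^+ 11 <= 2^-1 :> R.
  rewrite (_ : 11 = 2 * 4 + 2 + 1)%N// !exprD exprM expr1.
  apply: (@le_trans _ _ (3 / 5 * (7 / 8) * (14 / 15))); last lra.
  rewrite ler_wpM2r// ler_pM ?exprn_ge0//.
have q231 : (14 / 15) ^+ (231 * n) <= 2^-1 ^+ (21 * n) :> R.
  rewrite (_ : 231 * n = 11 * (21 * n))%N; last by rewrite mulnA.
  by rewrite exprM lerXn2r ?nnegrE ?exprn_ge0 ?invr_ge0.
have e4 : 4 = 2 ^+ 2 :> R by rewrite expr2; lra.
rewrite e4 -exprM -exprD.
apply: (@le_lt_trans _ _ (2 ^+ (18 * n + 2 * n) * 2^-1 ^+ (21 * n))).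
  by rewrite ler_wpM2l ?exprn_ge0.
rewrite (_ : 21 * n = (18 * n + 2 * n) + n)%N; last by rewrite -mulnDl -mulSnr.
rewrite [2^-1 ^+ _]exprD mulrA -exprMn mulfV ?pnatr_eq0// expr1n mul1r.
by rewrite exprn_ilt1 ?invr_ge0 ?invf_lt1 ?ltr1n// -lt0n.
Qed.

(* The vector 17 sqrt n xi is rounded to an integer vector, of norm at least 16 sqrt n, in such a
   way that its image under the sign matrix moves by at most N sqrt n / 2 in the l^1 norm. *)
Lemma sign_matrix n : (0 < n)%N ->
  exists X : 'I_(231 * n) -> {ffun 'I_n -> bool}, forall xi : 'rV[R]_n,
    dotv xi xi = 1 -> (231 * n)%:R / 34 <= \sum_i `|rsum (fun j => xi 0 j) (X i)|.
Proof.
move=> n0; set N := (231 * n)%N.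
have [X XP] := good_signs (good_signs_small n0).
exists X => xi xi1.
have nR0 : 0 < n%:R :> R by rewrite ltr0n.
pose r : R := Num.sqrt n%:R.
have r0 : 0 < r by rewrite sqrtr_gt0.
have r2 : r ^+ 2 = n%:R by rewrite sqr_sqrtr// ltW.
pose y j := 17 * r * xi 0 j.
pose v j : 'rV[R]_N := \row_i (-1) ^+ X i j.
have [z z1 z2] := vector_rounding y v.
pose d j := (z j)%:~R - y j.
have dvE : \sum_j d j *: v j = \row_i rsum d (X i).
  apply/rowP => i; rewrite summxE mxE; apply: eq_bigr => j _.
  by rewrite !mxE mulrC.
have vv : \sum_j dotv (v j) (v j) = n%:R * N%:R.
  rewrite (eq_bigr (fun=> N%:R)) ?sumr_const ?card_ord ?mulr_natl// => j _.
  rewrite /dotv (eq_bigr (fun=> 1)) ?sumr_const ?card_ord// => i _.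
  by rewrite mxE -expr2 sqrr_sign.
have d2 : \sum_i rsum d (X i) ^+ 2 <= 4^-1 * (n%:R * N%:R).
  rewrite -vv; apply: le_trans z2; rewrite -/(d _) dvE /dotv.
  by apply: ler_sum => i _; rewrite mxE -expr2.
have sum_xi : \sum_j xi 0 j ^+ 2 = 1.
  by rewrite -xi1; apply: eq_bigr => j _; rewrite expr2.
(* By AM-GM, sqrt n |xi_j| <= (1 + n xi_j^2) / 2, so [y] has l^1 norm at most 17 n; rounding adds at
   most n. *)
have zB : (\sum_j `|z j|%N <= 18 * n)%N.
  rewrite -(ler_nat R) natr_sum.
  apply: (@le_trans _ _ (\sum_j (17 * (2^-1 * (1 + n%:R * xi 0 j ^+ 2)) + 1))).
    apply: ler_sum => j _; rewrite natr_absz intr_norm.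
    have -> : (z j)%:~R = d j + y j by rewrite /d subrK.
    apply: le_trans (ler_normD _ _) _; rewrite addrC; apply: lerD; last exact: z1.
    rewrite /y !normrM [`|17|]ger0_norm// [`|r|]gtr0_norm// -mulrA ler_wpM2l//.
    have := sqr_ge0 (r * `|xi 0 j| - 1).
    rewrite sqrrB1 exprMn (real_normK (num_real _)) r2; lra.
  rewrite big_split /= -!mulr_sumr. rewrite big_split /= -mulr_sumr sum_xi.
  rewrite !sumr_const card_ord natrM; lra.
have [c cB cE] := cell_cover R zB.
have := XP c cB.
have -> : \sum_j cell_val R c j ^+ 2 = \sum_j (z j)%:~R ^+ 2.
  by apply: eq_bigr => j _; rewrite cE.
have -> : \sum_i `|rsum (cell_val R c) (X i)| = \sum_i `|rsum y (X i) + rsum d (X i)|.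
  apply: eq_bigr => i _; rewrite /rsum -big_split /=; congr `|_|.
  by apply: eq_bigr => j _; rewrite cE -mulrDr addrC /d subrK.
move=> h.
(* The weights are chosen so that 289 n = |y|^2 <= 17/16 |z|^2 + 17 n, which is |z|^2 >= 256 n. *)
have z_ge : 16 * r <= Num.sqrt (\sum_j (z j)%:~R ^+ 2).
  have -> : 16 * r = Num.sqrt (256 * n%:R).
    rewrite (_ : 256 * n%:R = (16 * r) ^+ 2); last by rewrite exprMn r2; ring.
    by rewrite sqrtr_sqr gtr0_norm// mulr_gt0.
  rewrite ler_sqrt; last by apply: sumr_ge0 => j _; exact: sqr_ge0.
  have : \sum_j y j ^+ 2 <= \sum_j (17 / 16 * (z j)%:~R ^+ 2 + 17).
    apply: ler_sum => j _; rewrite (_ : y j = (z j)%:~R - d j); last first.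
      by rewrite /d opprB addrC subrK.
    have := z1 j; rewrite -/(d j); move: ((z j)%:~R : R) (d j) => a b b1.
    have b2 : b ^+ 2 <= 1 by rewrite -(real_normK (num_real b)) exprn_ile1.
    have := sqr_ge0 (a / 4 + 4 * b); rewrite !expr2 in b2 *; lra.
  rewrite big_split /= -mulr_sumr sumr_const card_ord.
  rewrite (eq_bigr (fun j => 289 * n%:R * xi 0 j ^+ 2)); last first.
    by move=> j _; rewrite /y !exprMn r2; ring.
  rewrite -mulr_sumr sum_xi -[17 *+ n]mulr_natl; lra.
(* Cauchy-Schwarz in the form |a| <= a^2 / r + r / 4; each of the two parts sums to at most N r /
   4. *)
have d1 : \sum_i `|rsum d (X i)| <= N%:R * r / 2.
  apply: (@le_trans _ _ (\sum_i (r^-1 * rsum d (X i) ^+ 2 + r / 4))).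
    apply: ler_sum => i _.
    have := sqr_ge0 (`|rsum d (X i)| - r / 2).
    rewrite sqrrB (real_normK (num_real _)) => h1.
    rewrite -(ler_pM2l r0) mulrDr mulrA mulfV ?gt_eqF// mul1r.
    by move: h1; rewrite !expr2; lra.
  rewrite big_split /= -mulr_sumr sumr_const card_ord.
  have ri0 : 0 <= r^-1 by rewrite invr_ge0 ltW.
  have := ler_wpM2l ri0 d2.
  have -> : r^-1 * (4^-1 * (n%:R * N%:R)) = 4^-1 * (r * N%:R).
    by rewrite -r2; field; rewrite gt_eqF.
  rewrite -[r / 4 *+ _]mulr_natl -/N.
  lra.
have yE : \sum_i `|rsum y (X i)| = 17 * r * \sum_i `|rsum (fun j => xi 0 j) (X i)|.
  rewrite mulr_sumr; apply: eq_bigr => i _; rewrite /y rsumZ normrM.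
  by rewrite gtr0_norm// mulr_gt0.
have tri : \sum_i `|rsum y (X i) + rsum d (X i)| <=
    \sum_i `|rsum y (X i)| + \sum_i `|rsum d (X i)|.
  by rewrite -big_split; apply: ler_sum => i _; exact: ler_normD.
have h1 : N%:R / 16 * (16 * r) <= N%:R / 16 * Num.sqrt (\sum_j (z j)%:~R ^+ 2).
  by rewrite ler_wpM2l// divr_ge0.
(* From N r <= 17 r S + N r / 2, where S is the sum for xi; this is the origin of 34. *)
have h2 : r * (N%:R / 34) <= r * \sum_i `|rsum (fun j => xi 0 j) (X i)|.
  rewrite yE in tri; have := le_trans h1 (le_trans h tri).
  move: d1; rewrite -/N.
  move: (\sum_i `|rsum d (X i)|) (\sum_i `|rsum _ (X i)|) (N%:R : R) => D S M d1.
  lra.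
by rewrite ler_pM2l in h2.
Qed.

End sign_matrices.

(** * Volume of finite covers; translation of integrals *)

Section finite_cover.
Local Open Scope ereal_scope.
Context d (T : measurableType d) (R : realType) (mu : {measure set T -> \bar R}).

Lemma measure_finite_cover (I : finType) (P : pred I) (A : I -> set T) (B : set T)
    (b : R) : measurable B -> (forall c, measurable (A c)) ->
  (forall c, mu (A c) <= b%:E) -> (forall x, B x -> exists2 c, P c & A c x) ->
  mu B <= (#|P|%:R * b)%:E.
Proof.
move=> mB mA Ab BA.
have le_seq (s : seq I) : measurable (\big[setU/set0]_(c <- s) A c) /\
    mu (\big[setU/set0]_(c <- s) A c) <= ((size s)%:R * b)%:E.
  elim: s => [|c s [mU leU]].
    by rewrite big_nil mul0r measure0; split.
  rewrite big_cons; split; first exact: measurableU.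
  apply: le_trans (measureU2 _ _ _) _ => //.
  by rewrite /= -natr1 mulrDl mul1r addrC EFinD leeD.
have [mU leU] := le_seq (enum P).
rewrite cardE; apply: le_trans leU; apply: le_measure; [exact: mem_set|exact: mem_set|].
move=> x /BA[c Pc Acx]; rewrite -bigcup_seq /=; exists c => //=.
by rewrite mem_enum.
Qed.

End finite_cover.

Section translation.
Context {R : realType} {n : nat}.
Local Notation mu := (lebesgue_rV R n).

Lemma ge0_integral_shift (a : 'rV[R]_n) (F : 'rV[R]_n -> \bar R) :
  measurable_fun setT F -> (forall x, 0 <= F x)%E ->
  (\int[mu]_x F (x + a)%R = \int[mu]_x F x)%E.
Proof.
move=> mF F0; have ma := measurable_shift_rV a.
have := ge0_integral_pushforward ma mu measurableT mF (fun x _ => F0 x).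
rewrite preimage_setT => <-.
apply: eq_measure_integral => A mA _; exact: lebesgue_rV_shift.
Qed.

Lemma continuous_measurable_rV (g : 'rV[R]_n -> R) : continuous g ->
  measurable_fun setT g.
Proof.
move=> cg; apply: within_continuous_measurable_rV => //.
exact: continuous_subspaceT.
Qed.

Lemma continuous_mulmxr m (T : 'M[R]_(m, n)) :
  continuous (fun x : 'rV[R]_m => x *m T).
Proof.
move=> x A /nbhs_rVP[e e0 eA]; apply/nbhs_rVP.
pose C := \sum_i \sum_j `|T i j|.
have C0 : 0 <= C by apply: sumr_ge0 => i _; exact: sumr_ge0.
have C1 : 0 < C + 1 by lra.
exists (e / (C + 1)); first exact: divr_gt0.
move=> y xy; apply: eA => j.
apply: (@le_lt_trans _ _ (e / (C + 1) * C)); last first.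
  by rewrite mulrAC ltr_pdivrMr// ltr_pM2l// ltrDl.
rewrite !mxE -sumrB; apply: le_trans (ler_norm_sum _ _ _) _.
rewrite /C mulr_sumr; apply: ler_sum => i _.
rewrite -mulrBl normrM; apply: ler_pM => //; first exact/ltW/xy.
by rewrite (bigD1 j)//= lerDl; apply: sumr_ge0.
Qed.

End translation.

(* 2 ^ (232 n) * 4 ^ (231 n) * (2 ^ (10 n) * 4 ^ n) cubes of side 2 / sqrt n cover the polytope
   below. *)
Definition volume_cst (R : realType) : R :=
  2 ^+ 232 * 4 ^+ 231 * (2 ^+ 10 * 4) * 2.

Lemma volume_cst_gt0 (R : realType) : 0 < volume_cst R.
Proof.
by apply: mulr_gt0 => //; apply: mulr_gt0; apply: mulr_gt0 => //; exact: exprn_gt0.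
Qed.

(** * The lower bound: a polytope of small volume and its density *)

Section bumpy_polytope.
Context {R : realType} (n : nat).
Hypothesis n0 : (0 < n)%N.
Local Notation N := (231 * n)%N.
Variable X : 'I_N -> {ffun 'I_n -> bool}.
Hypothesis XP : forall xi : 'rV[R]_n, dotv xi xi = 1 ->
  N%:R / 34 <= \sum_i `|rsum (fun j => xi 0 j) (X i)|.
Local Notation mu := (lebesgue_rV R n).

Let r : R := Num.sqrt n%:R.

Let nR0 : 0 < n%:R :> R. Proof. by rewrite ltr0n. Qed.
Let r0 : 0 < r. Proof. by rewrite sqrtr_gt0. Qed.
Let r2 : r ^+ 2 = n%:R. Proof. by rewrite sqr_sqrtr// ltW. Qed.

Let vertex (i : 'I_N) : 'rV[R]_n := \row_j (-1) ^+ X i j.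

Let dotv_vertex i xi : dotv (vertex i) xi = rsum (fun j => xi 0 j) (X i).
Proof. by apply: eq_bigr => j _; rewrite mxE. Qed.

(* The convex hull of the points vertex i and - vertex i, thickened by a cube that leaves room
   for the bumps of f. *)
Let polytope : set 'rV[R]_n := [set w | exists (l : 'I_N -> R) (u : 'rV[R]_n),
  [/\ \sum_i `|l i| <= 1, (forall j, `|u 0 j| <= r^-1) &
      w = \sum_i l i *: vertex i + u]].

(** It is the image of a compact set of pairs (l, u) in dimension N + n under a linear map. *)
Let compact_polytope : compact polytope.
Proof.
pose S : set 'rV[R]_(N + n) := [set z | \sum_i `|z 0 (lshift n i)| <= 1] `&`
  \bigcap_j [set z | `|z 0 (rshift N j)| <= r^-1].
pose T : 'M[R]_(N + n, n) := col_mx (\matrix_i vertex i) 1%:M.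
have cz k : continuous (fun z : 'rV[R]_(N + n) => `|z 0 k|).
  move=> z; apply: (@continuous_comp _ _ _ (fun z : 'rV[R]_(N + n) => z 0 k)).
    exact: coord_continuous.
  exact: norm_continuous.
have cS : compact S.
  apply: bounded_closed_compact.
    exists (1 + r^-1); split; first exact: num_real.
    move=> M rM z [z1 zr]; rewrite /Num.norm /= mx_normrE.
    have r10 : 0 < r^-1 by rewrite invr_gt0.
    apply/bigmax_leP; split; first lra.
    move=> [i k] _ /=; rewrite ord1.
    case: (split_ordP k) => j ->; last first.
      by have := zr j I => /=; lra.
    have : `|z 0 (lshift n j)| <= \sum_i `|z 0 (lshift n i)|.
      by rewrite (bigD1 j)//= lerDl; apply: sumr_ge0.
    by move: z1 => /=; lra.
  apply: closedI.
    apply: (@preimage_closed _ _ (fun z : 'rV[R]_(N + n) =>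
      \sum_i `|z 0 (lshift n i)|) [set y | y <= 1]); last exact: closed_le.
    by move=> z _; apply: continuous_sum => i; exact: cz.
  apply: closed_bigI => j _.
  apply: (@preimage_closed _ _ (fun z : 'rV[R]_(N + n) => `|z 0 (rshift N j)|)
    [set y | y <= r^-1]); last exact: closed_le.
  by move=> z _; exact: cz.
rewrite (_ : polytope = (fun z => z *m T) @` S).
  by apply: continuous_compact => //; apply: continuous_subspaceT; exact: continuous_mulmxr.
have TE (z : 'rV[R]_(N + n)) : z *m T =
    \sum_i z 0 (lshift n i) *: vertex i + \row_j z 0 (rshift N j).
  rewrite -[z in LHS]hsubmxK mul_row_col mulmx1; congr (_ + _); last first.
    by apply/rowP => j; rewrite !mxE.
  rewrite mulmx_sum_row; apply: eq_bigr => i _.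
  by rewrite mxE rowK.
apply/seteqP; split => w.
  move=> [l [u [l1 ur ->]]].
  exists (row_mx (\row_i l i) u).
    split => /=.
      by under eq_bigr do rewrite row_mxEl mxE.
    by move=> j _ /=; rewrite row_mxEr.
  rewrite TE; congr (_ + _).
    by apply: eq_bigr => i _; rewrite row_mxEl mxE.
  by apply/rowP => j; rewrite mxE row_mxEr.
move=> [z [z1 zr] <-]; exists (fun i => z 0 (lshift n i)), (\row_j z 0 (rshift N j)).
by split=> // j; rewrite mxE; exact: zr.
Qed.

Let cube_sub_polytope (w : 'rV[R]_n) : (forall j, `|w 0 j| <= r^-1) -> polytope w.
Proof.
move=> wr; exists (fun=> 0), w; split => //.
  by rewrite big1// => i _; rewrite normr0.
by rewrite big1 ?add0r// => i _; rewrite scale0r.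
Qed.

Let vertex_cube_sub_polytope (b : bool) i (u : 'rV[R]_n) :
  (forall j, `|u 0 j| <= r^-1) -> polytope (u + (-1) ^+ b *: vertex i).
Proof.
move=> ur; exists (fun k => if k == i then (-1) ^+ b else 0), u; split => //.
  rewrite (bigD1 i)//= eqxx normrX normrN1 expr1n big1 ?addr0// => k /negbTE ->.
  exact: normr0.
rewrite (bigD1 i)//= eqxx big1 ?addr0 1?addrC// => k /negbTE ->.
by rewrite scale0r.
Qed.

Let convex_body_polytope : convex_body polytope.
Proof.
split; first exact: compact_polytope.
  apply/convex_setP => _ _ a [l [u [l1 ur ->]]] [l' [u' [l1' ur' ->]]] /andP[a0 a1].
  exists (fun i => a * l i + (1 - a) * l' i), (a *: u + (1 - a) *: u'); split.
  - apply: (@le_trans _ _ (a * \sum_i `|l i| + (1 - a) * \sum_i `|l' i|)).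
      rewrite !mulr_sumr -big_split; apply: ler_sum => i _ /=.
      apply: le_trans (ler_normD _ _) _.
      by rewrite !normrM [`|a|]ger0_norm// [`|1 - a|]ger0_norm ?subr_ge0.
    have : 0 <= a * (1 - \sum_i `|l i|) by rewrite mulr_ge0// subr_ge0.
    have : 0 <= (1 - a) * (1 - \sum_i `|l' i|) by rewrite mulr_ge0// subr_ge0.
    lra.
  - move=> j; rewrite !mxE; apply: le_trans (ler_normD _ _) _.
    rewrite !normrM [`|a|]ger0_norm// [`|1 - a|]ger0_norm ?subr_ge0//.
    have : 0 <= a * (r^-1 - `|u 0 j|) by rewrite mulr_ge0// subr_ge0.
    have : 0 <= (1 - a) * (r^-1 - `|u' 0 j|) by rewrite mulr_ge0// subr_ge0.
    lra.
  - rewrite !scalerDr addrACA; congr (_ + _).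
    rewrite !scaler_sumr -big_split; apply: eq_bigr => i _ /=.
    by rewrite !scalerA -scalerDl.
exists 0; apply/nbhs_rVP; exists r^-1; first by rewrite invr_gt0.
move=> y y0; apply: cube_sub_polytope => j.
by have := y0 j; rewrite mxE sub0r normrN => /ltW.
Qed.

Let symmetric_polytope : centrally_symmetric polytope.
Proof.
have opp w : polytope w -> polytope (- w).
  move=> [l [u [l1 ur ->]]]; exists (fun i => - l i), (- u); split.
  - by under eq_bigr do rewrite normrN.
  - by move=> j; rewrite mxE normrN.
  - by rewrite opprD -sumrN; congr (_ + _); apply: eq_bigr => i _; rewrite scaleNr.
apply/seteqP; split => [_ [w Kw <-]|w Kw]; first exact: opp.
by exists (- w); rewrite ?opprK//; exact: opp.
Qed.

(** The termwise inequality |a| <= a^2 / (16 r) + 4 r sums to (231/64 + 4) n r, which is below 8 n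
    r. *)
Let norm1_le_norm2 (e : 'rV[R]_n) : dotv e e <= 4^-1 * (N%:R * n%:R) ->
  \sum_j `|e 0 j| <= 8 * n%:R * r.
Proof.
move=> e2.
apply: (@le_trans _ _ (\sum_j ((16 * r)^-1 * (e 0 j * e 0 j) + 4 * r))).
  apply: ler_sum => j _.
  have r16 : 0 < 16 * r by rewrite mulr_gt0.
  rewrite -(ler_pM2l r16) mulrDr mulrA mulfV ?gt_eqF// mul1r.
  have := sqr_ge0 (`|e 0 j| - 8 * r).
  rewrite sqrrB (real_normK (num_real _)) !expr2; lra.
rewrite big_split /= -mulr_sumr sumr_const card_ord -[4 * r *+ n]mulr_natl.
have ri0 : 0 <= (16 * r)^-1 by rewrite invr_ge0 mulr_ge0// ltW.
have := ler_wpM2l ri0 e2; rewrite -/(dotv e e).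
rewrite (_ : (16 * r)^-1 * (4^-1 * (N%:R * n%:R)) = 231 / 64 * (n%:R * r)).
  have : 0 <= n%:R * r by rewrite mulr_ge0// ltW.
  lra.
by rewrite natrM -r2; field; rewrite gt_eqF.
Qed.

(** Rounding n l to z with error vector e turns a point into n^-1 sum_i z_i x_i + b, where b = u - e
    / n has l^1 norm at most 9 sqrt n. Rounding sqrt n b as well puts the point in a cube of radius
    1 / sqrt n, whose centre is given by integer vectors of l^1 norm at most n + 231 n and 9 n +
    n. *)
Let vol_polytope : (vol polytope <= ((volume_cst R / r) ^+ n)%:E)%E.
Proof.
pose ctr (c : cell N (232 * n) * cell n (10 * n)) : 'rV[R]_n :=
  n%:R^-1 *: \sum_i cell_val R c.1 i *: vertex i +
  r^-1 *: \row_j cell_val R c.2 j.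
pose P (c : cell N (232 * n) * cell n (10 * n)) :=
  (cell_size c.1 <= 232 * n)%N && (cell_size c.2 <= 10 * n)%N.
pose A c : set 'rV[R]_n := [set x : 'rV[R]_n | forall j, `|x 0 j - ctr c 0 j| <= r^-1].
have ri0 : 0 <= r^-1 by rewrite invr_ge0 ltW.
apply: (le_trans (@measure_finite_cover _ _ _ mu _ P A polytope ((2 * r^-1) ^+ n) _ _ _ _)).
- exact: compact_measurable_rV.
- by move=> c; exact: measurable_cube.
- by move=> c; rewrite le_eqVlt; apply/orP; left; apply/eqP; exact: lebesgue_cube.
- move=> _ [l [u [l1 ur ->]]].
  have [z z1 z2] := vector_rounding (fun i => n%:R * l i) vertex.
  set e := \sum_i _ *: vertex i in z2.
  have vv : \sum_i dotv (vertex i) (vertex i) = N%:R * n%:R.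
    rewrite (eq_bigr (fun=> n%:R)) ?sumr_const ?card_ord ?mulr_natl// => i _.
    rewrite /dotv (eq_bigr (fun=> 1)) ?sumr_const ?card_ord// => j _.
    by rewrite mxE -expr2 sqrr_sign.
  rewrite vv in z2; have e1 := norm1_le_norm2 z2.
  have zB : (\sum_i `|z i|%N <= 232 * n)%N.
    rewrite -(ler_nat R) natr_sum.
    apply: (@le_trans _ _ (\sum_i (n%:R * `|l i| + 1))).
      apply: ler_sum => i _; rewrite natr_absz intr_norm.
      have -> : (z i)%:~R = ((z i)%:~R - n%:R * l i) + n%:R * l i by rewrite subrK.
      apply: le_trans (ler_normD _ _) _; rewrite addrC; apply: lerD; last exact: z1.
      by rewrite normrM ger0_norm.
    rewrite big_split /= -mulr_sumr sumr_const card_ord.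
    have := ler_wpM2l (ltW nR0) l1; rewrite !natrM; lra.
  pose b := u - n%:R^-1 *: e.
  have b1 : r * \sum_j `|b 0 j| <= 9 * n%:R.
    have -> : 9 * n%:R = r * (n%:R * r^-1 + n%:R^-1 * (8 * n%:R * r)).
      by rewrite -r2; field; rewrite gt_eqF.
    rewrite ler_pM2l//.
    apply: (@le_trans _ _ (\sum_j (r^-1 + n%:R^-1 * `|e 0 j|))).
      apply: ler_sum => j _; rewrite !mxE; apply: le_trans (ler_normB _ _) _.
      by rewrite normrM [`|n%:R^-1|]ger0_norm ?invr_ge0// lerD2r.
    rewrite big_split /= sumr_const card_ord -[_ *+ n]mulr_natl lerD2l.
    by rewrite -mulr_sumr ler_wpM2l ?invr_ge0.
  (* With zero vectors only the entrywise error bound is of interest here. *)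
  have [z' z'1 _] := vector_rounding (fun j => r * b 0 j) (fun=> 0 : 'rV[R]_1).
  have z'B : (\sum_j `|z' j|%N <= 10 * n)%N.
    rewrite -(ler_nat R) natr_sum.
    apply: (@le_trans _ _ (\sum_j (r * `|b 0 j| + 1))).
      apply: ler_sum => j _; rewrite natr_absz intr_norm.
      have -> : (z' j)%:~R = ((z' j)%:~R - r * b 0 j) + r * b 0 j by rewrite subrK.
      apply: le_trans (ler_normD _ _) _; rewrite addrC; apply: lerD; last exact: z'1.
      by rewrite normrM [`|r|]gtr0_norm.
    rewrite big_split /= -mulr_sumr sumr_const card_ord natrM; lra.
  have [c cB cE] := cell_cover R zB; have [c' c'B c'E] := cell_cover R z'B.
  exists (c, c'); first by rewrite /P /= cB c'B.
  move=> j; rewrite /ctr /=.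
  have -> : \sum_i l i *: vertex i + u =
      n%:R^-1 *: (\sum_i cell_val R c i *: vertex i) + b.
    rewrite /b addrCA addrC -scalerBr; congr (_ + _).
    rewrite /e -sumrB scaler_sumr; apply: eq_bigr => i _.
    rewrite -scalerBl scalerA cE; congr (_ *: _).
    by rewrite subKr mulrA mulVf ?mul1r// gt_eqF.
  rewrite [(_ + b) 0 j]mxE [(_ + _ *: \row_j _) 0 j]mxE opprD addrACA subrr add0r.
  rewrite !mxE c'E -(ler_pM2l r0) mulfV ?gt_eqF// -[X in X * _](gtr0_norm r0).
  rewrite -normrM mulrBr mulrA mulfV ?gt_eqF// mul1r distrC.
  by have := z'1 j; rewrite !mxE.
rewrite lee_fin.
have -> : #|P|%:R = #|[pred c : cell N (232 * n) | (cell_size c <= 232 * n)%N]|%:R *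
    #|[pred c : cell n (10 * n) | (cell_size c <= 10 * n)%N]|%:R :> R.
  by rewrite -natrM -cardX; congr (_%:R); apply: eq_card => -[c c'].
have -> : (volume_cst R / r) ^+ n = (2 ^+ (232 * n) * 4 ^+ N) *
    ((2 ^+ (10 * n) * 4 ^+ n) * (2 * r^-1) ^+ n).
  by rewrite !exprM -!exprMn /volume_cst !mulrA.
rewrite -mulrA; apply: ler_pM => //; last first.
- apply: ler_wpM2r; [by rewrite exprn_ge0// mulr_ge0|exact: card_cells].
- exact: card_cells.
- by rewrite mulr_ge0// exprn_ge0// mulr_ge0.
Qed.

(** A tent in the sup norm, supported on the cube by which [polytope] is thickened. *)
Let bump (u : 'rV[R]_n) : R := Num.max 0 (r^-1 - `|u|).

Let f (w : 'rV[R]_n) : R := \sum_i (bump (w - vertex i) + bump (w + vertex i)).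

Let bump_ge0 u : 0 <= bump u.
Proof. by rewrite /bump le_max lexx. Qed.

Let bumpN u : bump (- u) = bump u.
Proof. by rewrite /bump normrN. Qed.

Let continuous_bump : continuous bump.
Proof.
have -> : bump = fun u : 'rV[R]_n => 2^-1 * ((r^-1 - `|u|) + `|r^-1 - `|u| |).
  apply/funext => u; rewrite /bump; have [h|h] := leP 0 (r^-1 - `|u|).
    by rewrite ger0_norm//; lra.
  by rewrite ltr0_norm//; lra.
move=> u; have cn := @norm_continuous R 'rV[R]_n u.
have ca : {for u, continuous (fun x : 'rV[R]_n => r^-1 - `|x|)}.
  exact: (cvgB (cvg_cst _) cn).
have cb : {for u, continuous (fun x : 'rV[R]_n => `|r^-1 - `|x| |)}.
  exact: (cvg_norm ca).
exact: (cvgM (cvg_cst _) (cvgD ca cb)).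
Qed.

Let entry_le_norm (u : 'rV[R]_n) j : `|u 0 j| <= `|u|.
Proof.
rewrite [leRHS]/Num.norm /= mx_normrE.
exact: (le_bigmax _ (fun ij => `|u ij.1 ij.2|) (0, j)).
Qed.

Let bump_support (b : bool) i w : ~ polytope w -> bump (w - (-1) ^+ b *: vertex i) = 0.
Proof.
move=> Kw; rewrite /bump; have [//|h] := leP (r^-1 - `|w - (-1) ^+ b *: vertex i|) 0.
exfalso; apply: Kw.
rewrite -[w](subrK ((-1) ^+ b *: vertex i)); apply: vertex_cube_sub_polytope => j.
by apply: le_trans (entry_le_norm _ _) _; rewrite ltW// -subr_gt0.
Qed.

Let f_support w : ~ polytope w -> f w = 0.
Proof.
move=> Kw; rewrite /f big1// => i _.
have := bump_support false i Kw; rewrite expr0 scale1r => ->.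
have := bump_support true i Kw; rewrite expr1 scaleN1r opprK => ->.
by rewrite addr0.
Qed.

Let f_ge0 w : 0 <= f w.
Proof. by apply: sumr_ge0 => i _; rewrite addr_ge0. Qed.

Let f_even : even_on polytope f.
Proof.
move=> w _; apply: eq_bigr => i _; rewrite addrC -bumpN opprD !opprK; congr (_ + _).
by rewrite -bumpN opprB opprK addrC.
Qed.

Let continuous_shift (a : 'rV[R]_n) : continuous (fun w : 'rV[R]_n => w + a).
Proof. by move=> w; exact: (cvgD cvg_id (cvg_cst a)). Qed.

Let continuous_bump_shift (a : 'rV[R]_n) :
  continuous (fun w : 'rV[R]_n => bump (w + a)).
Proof.
move=> w; apply: (@continuous_comp _ _ _ (fun w : 'rV[R]_n => w + a)).
  exact: continuous_shift.
exact: continuous_bump.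
Qed.

Let continuous_f : continuous f.
Proof.
apply: continuous_sum => i w.
exact: (cvgD (@continuous_bump_shift _ w) (@continuous_bump_shift _ w)).
Qed.

(** As f vanishes off [polytope], the integral extends to the whole space, where each bump can be
    moved to the origin; this pairs the values of g at x + v and x - v. *)
Let integral_f (g : 'rV[R]_n -> R) : continuous g -> (forall x, 0 <= g x) ->
  (\int[mu]_(x in polytope) (g x * f x)%:E =
   \sum_i (\int[mu]_x ((g (x + vertex i) + g (x - vertex i)) * bump x)%:E))%E.
Proof.
move=> cg g0.
have mg : measurable_fun setT g := continuous_measurable_rV cg.
have mb (a : 'rV[R]_n) : measurable_fun setT (fun w : 'rV[R]_n => bump (w + a)).
  exact: continuous_measurable_rV.
have mF (a : 'rV[R]_n) : measurable_fun setT (fun x => (g x * bump (x + a))%:E).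
  by apply/measurable_EFinP; exact: measurable_funM.
have F0 (a x : 'rV[R]_n) : (0 <= (g x * bump (x + a))%:E)%E by rewrite lee_fin mulr_ge0.
rewrite integral_mkcond.
transitivity (\int[mu]_x \sum_i ((g x * bump (x - vertex i))%:E +
    (g x * bump (x + vertex i))%:E))%E.
  apply: eq_integral => x _; rewrite patchE.
  have -> : (\sum_i ((g x * bump (x - vertex i))%:E +
      (g x * bump (x + vertex i))%:E))%E = (g x * f x)%:E.
    rewrite /f mulr_sumr -sumEFin; apply: eq_bigr => i _.
    by rewrite -EFinD mulrDr.
  case: ifPn => // /negP Kx; rewrite f_support ?mulr0// => Kx'.
  by apply: Kx; exact: mem_set.
rewrite ge0_integral_sum//; last 2 first.
- by move=> i; exact: emeasurable_funD.
- by move=> i x _; rewrite adde_ge0.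
apply: eq_bigr => i _.
rewrite ge0_integralD//.
rewrite -(ge0_integral_shift (vertex i) (mF (- vertex i)) (F0 _)).
rewrite -(ge0_integral_shift (- vertex i) (mF (vertex i)) (F0 _)).
have mS (a : 'rV[R]_n) : measurable_fun setT (fun x : 'rV[R]_n => (g (x + a) * bump x)%:E).
  apply/measurable_EFinP; apply: measurable_funM.
    exact: measurableT_comp mg (measurable_shift_rV a).
  exact: (continuous_measurable_rV continuous_bump).
rewrite -ge0_integralD//.
- by apply: eq_integral => x _; rewrite addrK subrK -EFinD mulrDl.
- apply: eq_measurable_fun (mS (vertex i)) => x _.
  by rewrite addrK.
- apply: eq_measurable_fun (mS (- vertex i)) => x _.
  by rewrite subrK.
Qed.

Let eta : \bar R := (\int[mu]_x (bump x)%:E)%E.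

Let mbump : measurable_fun setT (fun x => (bump x)%:E).
Proof. by apply/measurable_EFinP; exact: continuous_measurable_rV. Qed.

Let eta_gt0 : (0 < eta)%E.
Proof.
pose C := [set x : 'rV[R]_n | forall j, `|x 0 j - (0 : 'rV[R]_n) 0 j| <= r^-1 / 2].
have ri0 : 0 < r^-1 by rewrite invr_gt0.
have mC : measurable C by exact: measurable_cube.
apply: (@lt_le_trans _ _ (\int[mu]_(x in C) (r^-1 / 2)%:E)%E).
  rewrite integral_cst//; apply: mule_gt0; first by rewrite lte_fin divr_gt0.
  change (0 < lebesgue_rV R n C)%E.
  rewrite /C lebesgue_cube ?divr_ge0 ?(ltW ri0)//.
  by rewrite lte_fin exprn_gt0// mulr_gt0// divr_gt0.
apply: (@le_trans _ _ (\int[mu]_(x in C) (bump x)%:E)%E).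
  apply: ge0_le_integral => //.
  - by move=> x _; rewrite lee_fin divr_ge0// ltW.
  - exact: measurable_funTS.
  move=> x Cx; rewrite lee_fin /bump le_max; apply/orP; right.
  have : `|x| <= r^-1 / 2.
    rewrite /Num.norm /= mx_normrE; apply/bigmax_leP; split; first by rewrite divr_ge0// ltW.
    by move=> [i j] _ /=; rewrite ord1; have := Cx j; rewrite mxE subr0.
  lra.
apply: ge0_subset_integral => //.
by move=> x _; rewrite lee_fin.
Qed.

Let J := wint mu polytope f (fun=> 1).

Let bf : bmeas polytope f.
Proof. by apply: body_bmeas => //; exact: continuous_subspaceT. Qed.

Let mK : measurable polytope. Proof. exact: compact_measurable_rV. Qed.

Let vK : (mu polytope < +oo)%E. Proof. exact: compact_volume_lty. Qed.

Let JE : J%:E = ((2 * N%:R)%:E * eta)%E.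
Proof.
rewrite /J -wintE//; last exact: bmeas_cst.
rewrite (integral_f (g := fun=> 1))//; last exact: cst_continuous.
rewrite (eq_bigr (fun=> (2%:E * eta)%E)); last first.
  move=> i _; by rewrite -ge0_integralZl_EFin// => x _; rewrite lee_fin.
rewrite -ge0_sume_distrl; last by move=> i _; rewrite lee_fin.
by rewrite sumEFin sumr_const card_ord mulr_natr.
Qed.

Let J_gt0 : 0 < J.
Proof.
rewrite -lte_fin JE; apply: mule_gt0 eta_gt0.
by rewrite lte_fin; apply: mulr_gt0; rewrite ltr0n// muln_gt0.
Qed.

(** By the triangle inequality each vertex contributes at least 2 |(v, xi)| [eta]. With [XP] the
    total is at least 2 (N / 34) [eta], while J = 2 N [eta]. The constant is written as 2 * 68^-1 to
    match [wint_powR_ge1]. *)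
Let moment1_ge xi : sphere xi ->
  2 * 68^-1 * J <= wint mu polytope f (fun x => `|dotv x xi|).
Proof.
move=> /sphereP xi1.
have cd : continuous (fun x : 'rV[R]_n => `|dotv x xi|).
  move=> x; apply: (@continuous_comp _ _ _ (fun x : 'rV[R]_n => dotv x xi)).
    exact: continuous_dotvr.
  exact: norm_continuous.
have [md [B dB]] := bmeas_dotv compact_polytope xi.
have bd : bmeas polytope (fun x => `|dotv x xi|).
  split; first exact: measurableT_comp.
  by exists B => x Kx; rewrite normr_id; exact: dB.
rewrite -lee_fin -wintE// integral_f//.
apply: (@le_trans _ _ (\sum_i (2 * `|dotv (vertex i) xi|)%:E * eta)%E); last first.
  apply: lee_sum => i _; rewrite -ge0_integralZl_EFin//; last by move=> x _; rewrite lee_fin.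
  apply: ge0_le_integral => //.
  - by move=> x _; rewrite -EFinM lee_fin !mulr_ge0.
  - exact: measurable_funeM.
  - apply/measurable_EFinP; apply: measurable_funM; last exact/measurable_EFinP.
    have cs (a : 'rV[R]_n) : continuous (fun x : 'rV[R]_n => `|dotv (x + a) xi|).
      move=> x; exact: (@continuous_comp _ _ _ (fun w : 'rV[R]_n => w + a)
        (fun x : 'rV[R]_n => `|dotv x xi|) x (@continuous_shift a x) (@cd (x + a))).
    apply: continuous_measurable_rV => x.
    exact: (cvgD (@cs (vertex i) x) (@cs (- vertex i) x)).
  move=> x _; rewrite -EFinM lee_fin ler_wpM2r//.
  have -> : 2 * `|dotv (vertex i) xi| =
      `|dotv (x + vertex i) xi - dotv (x - vertex i) xi|.
    rewrite -[- vertex i]scaleN1r !dotvDl dotvZl -[2 in LHS](ger0_norm (ler0n R 2)) -normrM.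
    by congr `|_|; ring.
  exact: ler_normB.
rewrite -ge0_sume_distrl; last by move=> i _; rewrite lee_fin mulr_ge0.
rewrite EFinM JE muleA -EFinM sumEFin; apply: lee_wpmul2r; first exact: ltW.
rewrite lee_fin -mulr_sumr; have := XP xi1.
have -> : \sum_i `|dotv (vertex i) xi| = \sum_i `|rsum (fun j => xi 0 j) (X i)|.
  by apply: eq_bigr => i _; rewrite dotv_vertex.
by move: (\sum_i `|_|) (N%:R : R) => S M; lra.
Qed.

(** The p-th moment is at least 68^(-p) J in every direction; cancelling J and taking p-th roots
    leaves 1/68 <= gamma |K|^(1/n), from which p has disappeared. *)
Lemma moment_bound_ge (p gamma : R) : 1 <= p -> 0 < gamma ->
  moment_bound p n gamma -> (68 * volume_cst R)^-1 * Num.sqrt n%:R <= gamma.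
Proof.
move=> p1 gamma0 bound; have p0 : 0 < p by lra.
have [m [[xi xis <-] _]] := bound polytope f convex_body_polytope
  symmetric_polytope (continuous_subspaceT continuous_f) (fun x _ => f_ge0 x) f_even.
have body := body_volumeE convex_body_polytope.
rewrite momentE ?(ltW p0)//; last exact: continuous_subspaceT.
rewrite (_ : (\int[lebesgue_rV R n]_(x in polytope) (f x)%:E)%E = J%:E); last first.
  by rewrite /J -wintE//; [apply: eq_integral => x _; rewrite mul1r|exact: bmeas_cst].
rewrite body poweR_EFin -!EFinM lee_fin => up.
have low : 68^-1 `^ p * J <= rmoment polytope f p xi.
  apply: wint_powR_ge1 => //; [exact: bmeas_dotv|exact: moment1_ge].
have V0 : 0 <= fine (vol polytope).
  by rewrite -lee_fin -body; exact: measure_ge0.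
set v := fine (vol polytope) `^ n%:R^-1.
have vE : fine (vol polytope) `^ (p / n%:R) = v `^ p.
  by rewrite /v -powRrM mulrC.
have D0 := volume_cst_gt0 R.
have v_le : v <= volume_cst R / r.
  have Dr0 : 0 <= volume_cst R / r by rewrite divr_ge0// ltW.
  have : fine (vol polytope) <= (volume_cst R / r) ^+ n.
    by rewrite -lee_fin -body; exact: vol_polytope.
  rewrite -powR_mulrn// => h.
  have := ge0_ler_powR (r := n%:R^-1) _ _ _ h.
  rewrite -powRrM mulfV ?gt_eqF// powRr1// -/v; apply.
  - by rewrite invr_ge0.
  - by rewrite nnegrE.
  - by rewrite nnegrE powR_ge0.
rewrite vE -powRM ?(ltW gamma0) ?powR_ge0// in up.
have := le_trans low up; rewrite ler_pM2r// => sp.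
have s_le : 68^-1 <= gamma * v.
  rewrite leNgt; apply/negP => h.
  have gv0 : 0 <= gamma * v by rewrite mulr_ge0 ?powR_ge0 ?(ltW gamma0).
  have := gt0_ltr_powR p0 _ _ h; rewrite !nnegrE invr_ge0 => /(_ gv0 (ler0n _ _)).
  by rewrite ltNge sp.
have : 68^-1 <= gamma * (volume_cst R / r).
  by apply: le_trans s_le _; rewrite ler_wpM2l// ltW.
rewrite mulrA ler_pdivlMr// => h.
by rewrite -/r invfM mulrAC ler_pdivrMr.
Qed.

End bumpy_polytope.

(** * Existence of gamma and the two bounds *)

Section gamma.
Context {R : realType}.

(** For fixed K and f with a J > 0 the condition on g reads (m / (a J))^(1/p) <= g, which passes to
    the infimum. If a J = 0, the bound for [g0] already gives m <= 0. *)
Lemma moment_bound_inf (n : nat) (p g0 : R) : (0 < n)%N -> 1 <= p ->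
  let G := [set g | 0 < g /\ moment_bound p n g] in
  G g0 -> 0 < inf G -> moment_bound p n (inf G).
Proof.
move=> n0 p1 G Gg0 inf0 K f bK sK cf f0 ev.
have p0 : 0 < p by lra.
have kK : compact K by case: bK.
have [xi xis xi_least] := least_moment kK cf f0 n0 p1.
exists (moment K f p xi) => //.
have [J0 JE] : 0 <= wint (lebesgue_rV R n) K f (fun=> 1) /\
    (\int[lebesgue_rV R n]_(x in K) (f x)%:E)%E =
    (wint (lebesgue_rV R n) K f (fun=> 1))%:E.
  split; first exact: wint_ge0.
  rewrite -wintE//.
  - by apply: eq_integral => x _; rewrite mul1r.
  - exact: compact_measurable_rV.
  - exact: compact_volume_lty.
  - exact: body_bmeas.
  - exact: bmeas_cst.
rewrite JE (body_volumeE bK) poweR_EFin momentE ?(ltW p0)// -!EFinM lee_fin.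
set a := fine (vol K) `^ (p / n%:R); set J := wint _ _ _ _ in J0 JE *.
set m := rmoment K f p xi.
have le_G g : G g -> m <= g `^ p * (a * J).
  move=> [g_gt0 /(_ K f bK sK cf f0 ev)[_ [[eta etas <-] _]]].
  case: xi_least => _ /(_ _ (ex_intro2 _ _ eta etas erefl)) /le_trans h /h.
  by rewrite JE (body_volumeE bK) poweR_EFin momentE ?(ltW p0)// -!EFinM lee_fin mulrA.
have aJ0 : 0 <= a * J by rewrite mulr_ge0 ?powR_ge0.
rewrite -mulrA; have [aJ|aJ] := eqVneq (a * J) 0.
  by rewrite aJ mulr0; have := le_G _ Gg0; rewrite aJ mulr0.
have aJ_gt0 : 0 < a * J by rewrite lt_neqAle eq_sym aJ.
rewrite -ler_pdivrMr//.
have q0 : 0 <= m / (a * J).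
  by rewrite divr_ge0//; apply: wint_ge0 => // x _; exact: powR_ge0.
have -> : m / (a * J) = ((m / (a * J)) `^ p^-1) `^ p.
  by rewrite -powRrM mulVf ?gt_eqF// powRr1.
rewrite ge0_ler_powR ?nnegrE ?powR_ge0 ?(ltW p0) ?(ltW inf0)//.
apply: lb_le_inf; first by exists g0.
move=> g Gg; have g_ge0 : 0 <= g by case: Gg => /ltW.
have -> : g = (g `^ p) `^ p^-1 by rewrite -powRrM mulfV ?gt_eqF// powRr1.
rewrite ge0_ler_powR ?nnegrE ?powR_ge0 ?invr_ge0 ?(ltW p0)//.
by rewrite ler_pdivrMr//; exact: le_G.
Qed.

(** This amounts to e < 3, which follows from exp (- 1/8) >= 7/8 and (8/7)^8 < 3. *)
Lemma ln_ln3_gt0 : 0 < ln (ln 3) :> R.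
Proof.
rewrite ln_gt0// -ltr_expR lnK ?posrE//.
have h : expR (1 / 8) <= 8 / 7 :> R.
  rewrite -[1 / 8]opprK expRN invf_ple ?posrE ?expR_gt0//.
  by apply: le_trans (expR_ge1Dx _); lra.
have -> : expR 1 = expR (1 / 8) ^+ 8 :> R by rewrite -expRM_natl; congr expR; lra.
apply: (@le_lt_trans _ _ ((8 / 7) ^+ 8)).
  by rewrite lerXn2r ?nnegrE ?expR_ge0 ?divr_ge0.
by rewrite !exprS expr0; lra.
Qed.

End gamma.


Theorem theorem1p1 (R : realType) :
  exists c C : R, [/\ 0 < c, 0 < C &
    forall (n : nat) (p : R), (3 <= n)%N -> 1 <= p ->
      exists2 gamma : R, is_gamma p n gamma &
        c * Num.sqrt n%:R / Num.sqrt (ln (ln n%:R)) <= gamma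
          <= C * Num.sqrt (p * n%:R)].
Proof.
pose c0 : R := (68 * volume_cst R)^-1.
have c0_gt0 : 0 < c0 by rewrite invr_gt0; apply: mulr_gt0 (volume_cst_gt0 R).
have l3 := @ln_ln3_gt0 R.
(* The factor sqrt (ln (ln 3)) makes the quotient by sqrt (ln (ln n)) at most [c0] for all n >=
   3. *)
exists (c0 * Num.sqrt (ln (ln 3))), (4 * upper_cst); split.
- by rewrite mulr_gt0// sqrtr_gt0.
- by rewrite mulr_gt0// upper_cst_gt0.
move=> n p n3 p1.
have n0 : (0 < n)%N by apply: leq_trans n3.
have nR0 : 0 < n%:R :> R by rewrite ltr0n.
pose G := [set g : R | 0 < g /\ moment_bound p n g].
have Gup : G (4 * upper_cst * Num.sqrt (p * n%:R)).
  split; last exact: moment_bound_upper.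
  by rewrite !mulr_gt0 ?upper_cst_gt0// sqrtr_gt0 mulr_gt0//; lra.
have [X XP] := @sign_matrix R n n0.
have Glow : lbound G (c0 * Num.sqrt n%:R).
  by move=> g [g0 gb]; exact: (moment_bound_ge n0 XP p1 g0 gb).
have infG : c0 * Num.sqrt n%:R <= inf G.
  by apply: lb_le_inf => //; exists (4 * upper_cst * Num.sqrt (p * n%:R)).
have inf_gt0 : 0 < inf G by apply: lt_le_trans infG; rewrite mulr_gt0 ?sqrtr_gt0.
have hasG : has_lbound G by exists (c0 * Num.sqrt n%:R).
exists (inf G).
  split; last by move=> g Gg; exact: ge_inf.
  by split=> //; exact: moment_bound_inf Gup inf_gt0.
apply/andP; split; last exact: ge_inf.
apply: le_trans infG; rewrite mulrAC -mulrA -[leRHS]mulr1 -!mulrA ler_pM2l//.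
have ln3 : 0 < ln 3 :> R by rewrite ln_gt0// ltr1n.
have le_ln : ln (ln 3) <= ln (ln n%:R) :> R.
  have h : ln 3 <= ln n%:R :> R by rewrite ler_ln ?posrE// ler_nat.
  by rewrite ler_ln ?posrE//; exact: lt_le_trans h.
have s0 : 0 < Num.sqrt (ln (ln n%:R)) :> R by rewrite sqrtr_gt0 (lt_le_trans l3).
have : Num.sqrt (ln (ln 3)) / Num.sqrt (ln (ln n%:R)) <= 1 :> R.
  by rewrite ler_pdivrMr// mul1r ler_sqrt// (le_trans (ltW l3)).
have := sqrtr_ge0 (n%:R : R); nra.
Qed.
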